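(* Let $V$ be a $C$-vector space of dimension $n\ge 2$, let $G\subset \mathrm{GL}(V)$ be an irreducible finite group with image $G^p$ in $\mathrm{PGL}(V)$, and let $Z\subset\mathbb{P}(V)$ be as follows: $Z=\mathbb{P}(V)$ if $n=2$; and if $n>2$, $Z$ is an irreducible $G^p$-invariant curve such that the normalisation of $Z/G^p$ has genus $0$. Identify the function field of $Z/G^p$ with $C(z)$ and fix an embedding $C(Z)\subset\overline{C(z)}$ over $C(z)$. Let $\ell\in V\setminus\{0\}$ and $f\in\overline{C(z)}^*$ be such that $W:=f\cdot\frac{V}{\ell}\subset\overline{C(z)}$ is invariant under $\pi$, and let $L_{st}$ be the standard operator constructed from $W$. Then: (1) $L_{st}$ does not depend on the choices of $\ell$ and $f$. (2) The solution space of $L_{st}$ in $\overline{C(z)}$ has the form $g\cdot W$ for a certain $g\in\overline{C(z)}^*$. (3) The differential Galois group $H$ of $L_{st}$ lies in $\mathrm{SL}(g\cdot W)$. (4) If the projective spaces $\mathbb{P}(V)$ and $\mathbb{P}(g\cdot W)$ are canonically identified (via $v\mapsto g f\frac{v}{\ell}$), then $H^p=G^p$ (where $H^p$ is the image of $H$ in $\mathrm{PGL}(g\cdot W)$) and the Fano curve of $L_{st}$ is equal to $Z$.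
   Context: $C$ is an algebraically closed field of characteristic zero, $C(z)$ has derivation $\frac{d}{dz}$, extended uniquely to the algebraic closure $\overline{C(z)}$, and $\pi=\mathrm{Gal}(\overline{C(z)}/C(z))$. Elements of $V$ are regarded as homogeneous linear coordinates on $\mathbb{P}(V)$ (i.e. $\mathbb{P}(V)=\mathrm{Proj}$ of the symmetric algebra of $V$), so that for $v,\ell\in V$ with $\ell\neq0$ the quotient $\frac{v}{\ell}$ is a rational function on $Z$ (by irreducibility of $G$, no nonzero $\ell$ vanishes identically on $Z$); $\frac{V}{\ell}=\{\frac{v}{\ell}: v\in V\}\subset C(Z)$. The group $G^p$ acts faithfully on $C(Z)$ by $\sigma(\frac{v}{\ell})=\frac{\tilde\sigma v}{\tilde\sigma\ell}$, where $\tilde\sigma\in G$ is any lift of $\sigma$, and $C(Z)^{G^p}=C(z)$. (For $n=2$, $z$ is chosen such that $0,1,\infty$ are the branch points of $Z\to Z/G^p=\mathbb{P}^1_z$.) For every $\ell\in V\setminus\{0\}$ there exists $f\in\overline{C(z)}^*$ such that $f\frac{V}{\ell}$ is $\pi$-invariant. Standard operator: let $L$ be the monic operator of order $n$ over $\overline{C(z)}$ with $\ker(L,\overline{C(z)})=W=f\cdot\frac{V}{\ell}$. Since $W$ is $\pi$-invariant, $L$ has coefficients in $C(z)$. The standard operator $L_{st}$ is the operator of the form $(\frac{d}{dz})^n+0\cdot(\frac{d}{dz})^{n-1}+\cdots$ obtained from $L$ by a shift $\frac{d}{dz}\mapsto\frac{d}{dz}+a$ for a suitable $a=\frac{h'}{h}$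 with $h\in\overline{C(z)}^*$. Fano curve: for a monic operator of order $n$ over $C(z)$ with full ($n$-dimensional) solution space $M\subset\overline{C(z)}$, let $\phi:\mathrm{Sym}(M)\to\overline{C(z)}$ be the $C$-algebra homomorphism from the symmetric algebra of $M$ that extends the inclusion of $M$. For $n>2$ the Fano curve is the irreducible curve in $\mathbb{P}(M)=\mathrm{Proj}(\mathrm{Sym}(M))$ defined by the ideal generated by the homogeneous elements of $\ker\phi$; for $n=2$ the Fano curve is by convention $\mathbb{P}(M)$ itself. The differential Galois group is the image of $\pi$ in $\mathrm{GL}(M)$. *)

(* Defs.v *)
From HB Require Import structures.
From mathcomp Require Import all_boot all_order all_algebra all_fingroup.
From mathcomp Require Import generic_quotient ring_quotient fraction mxrepresentation.
From mathcomp Require Import boolp.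
From mathcomp Require Export mpoly.

Set Implicit Arguments.
Unset Strict Implicit.
Unset Printing Implicit Defensive.

Import GRing.Theory.
Local Open Scope ring_scope.
Local Open Scope quotient_scope.

(* V is C^n, written as row vectors, and Sym(V) is {mpoly C[n]}: the vector v  *)
(* is identified with the linear form lin v.  An integral closed subscheme of  *)
(* P(V) = Proj(Sym V) is given by its homogeneous prime ideal, which must not  *)
(* contain all the coordinates.                                                *)

Section ProjectiveSpace.
Variables (C : fieldType) (n : nat).

Definition lin (v : 'rV[C]_n) : {mpoly C[n]} := \sum_(i < n) v 0 i *: 'X_i.

(* Automorphism of Sym(V) extending v |-> v *m A.                              *)
Definition sym_act (A : 'M[C]_n) (p : {mpoly C[n]}) : {mpoly C[n]} :=
  p \mPo [tuple lin (row i A) | i < n].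

Definition irreducible_closed (I : prime_idealr {mpoly C[n]}) : Prop :=
  (forall p d, p \in I -> pihomog mdeg d p \in I) /\ exists i, 'X_i \notin I.

Definition ideal_generated (P : {mpoly C[n]} -> Prop) (p : {mpoly C[n]}) : Prop :=
  exists m (a q : 'I_m -> {mpoly C[n]}),
    (forall i, P (q i)) /\ p = \sum_(i < m) a i * q i.

End ProjectiveSpace.

Section PrimeQuotient.
Variables (R : comNzRingType) (I : prime_idealr R).

Definition prime_quot : Type := {ideal_quot I}.
HB.instance Definition _ := GRing.ComNzRing.on prime_quot.

Definition to_quot (p : R) : prime_quot := \pi_({ideal_quot I}) p.

(* {ideal_quot I} is only a ring: to be an integral domain it also needs the   *)
(* structure of a unit ring, chosen classically.                               *)
Definition prime_quot_unit : pred prime_quot := fun x => `[< exists y, y * x = 1 >].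
Definition prime_quot_inv (x : prime_quot) : prime_quot :=
  if pselect (exists y, y * x = 1) is left ex then projT1 (cid ex) else x.

Fact prime_quot_mulVx : {in prime_quot_unit, left_inverse 1 prime_quot_inv *%R}.
Proof.
move=> x /asboolP ux; rewrite /prime_quot_inv; case: pselect => // ex.
exact: projT2 (cid ex).
Qed.

Fact prime_quot_unitPl (x y : prime_quot) : y * x = 1 -> prime_quot_unit x.
Proof. by move=> yx1; apply/asboolP; exists y. Qed.

Fact prime_quot_inv_out : {in [predC prime_quot_unit], prime_quot_inv =1 id}.
Proof.
move=> x; rewrite !inE => /asboolP ux.
by rewrite /prime_quot_inv; case: pselect.
Qed.

HB.instance Definition _ := GRing.ComNzRing_hasMulInverse.Build prime_quot
  prime_quot_mulVx prime_quot_unitPl prime_quot_inv_out.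

Fact prime_quot_idomain : GRing.integral_domain_axiom prime_quot.
Proof. exact: Quotient.rquot_IdomainAxiom. Qed.

HB.instance Definition _ :=
  GRing.ComUnitRing_isIntegral.Build prime_quot prime_quot_idomain.

Lemma to_quot_is_zmod_morphism : zmod_morphism to_quot.
Proof. exact: raddfB. Qed.

Lemma to_quot_is_monoid_morphism : monoid_morphism to_quot.
Proof. by split; [exact: rmorph1 | exact: rmorphM]. Qed.

HB.instance Definition _ :=
  GRing.isZmodMorphism.Build R prime_quot to_quot to_quot_is_zmod_morphism.
HB.instance Definition _ :=
  GRing.isMonoidMorphism.Build R prime_quot to_quot to_quot_is_monoid_morphism.

Lemma to_quot_eq0 p : (to_quot p == 0) = (p \in I).
Proof. by rewrite /to_quot piE Quotient.equivE subr0. Qed.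

End PrimeQuotient.

Section Subfield.
Variables (F : fieldType) (S : divringClosed F).

Record subfield : Type := Subfield { subfield_val :> F; _ : subfield_val \in S }.

HB.instance Definition _ := [isSub for subfield_val].
HB.instance Definition _ := [Choice of subfield by <:].
HB.instance Definition _ := [SubChoice_isSubIntegralDomain of subfield by <:].
HB.instance Definition _ := [SubIntegralDomain_isSubField of subfield by <:].

End Subfield.

(* The function field of the subvariety defined by I: the fractions p/q with   *)
(* p and q homogeneous of the same degree, inside the fraction field of the    *)
(* homogeneous coordinate ring.                                                *)

Section FunctionField.
Variables (C : fieldType) (n : nat) (I : prime_idealr {mpoly C[n]}).
Implicit Types (p q : {mpoly C[n]}).

Local Notation coord_ring := (prime_quot I).
Local Notation coord := (to_quot I).

Definition coord_frac p q : {fraction coord_ring} :=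
  FracField.tofrac (coord p) / FracField.tofrac (coord q).

Definition degree0 : pred {fraction coord_ring} := fun u =>
  `[< exists d p q, [/\ p \is d.-homog, q \is d.-homog, q \notin I
                      & u = coord_frac p q] >].

Fact coord_tofrac_neq0 q : q \notin I -> FracField.tofrac (coord q) != 0.
Proof. by rewrite tofrac_eq0 to_quot_eq0. Qed.

Fact degree0_divring_closed : divring_closed degree0.
Proof.
split.
- apply/asboolP; exists 0%N, 1, 1; split; rewrite ?dhomog1 //.
    by rewrite idealr1.
  by rewrite /coord_frac rmorph1 tofrac1 divr1.
- move=> u v /asboolP[d [p [q [hp hq nq ->]]]] /asboolP[d' [p' [q' [hp' hq' nq' ->]]]].
  apply/asboolP; exists (d + d')%N, (p * q' - p' * q), (q * q'); split.
  + apply: rpredB; first exact: dhomogM.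
    by rewrite addnC; apply: dhomogM.
  + by rewrite dhomogM.
  + by rewrite prime_idealrM negb_or nq.
  + rewrite /coord_frac rmorphB !rmorphM /= tofracB !tofracM.
    by rewrite -mulNr addf_div ?coord_tofrac_neq0 // mulNr.
- move=> u v /asboolP[d [p [q [hp hq nq ->]]]] /asboolP[d' [p' [q' [hp' hq' nq' ->]]]].
  apply/asboolP; case: (boolP (p' \in I)) => Ip'.
    exists 0%N, 0, 1; split; rewrite ?dhomog1 ?rpred0 ?idealr1 //.
    move: Ip'; rewrite /coord_frac -to_quot_eq0 => /eqP->.
    by rewrite !rmorph0 !mul0r invr0 mulr0.
  exists (d + d')%N, (p * q'), (q * p'); split; rewrite ?dhomogM //.
    by rewrite prime_idealrM negb_or nq.
  by rewrite /coord_frac !rmorphM /= invf_div mulf_div.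
Qed.

HB.instance Definition _ :=
  GRing.isDivringClosed.Build {fraction coord_ring} degree0
    degree0_divring_closed.

Definition function_field : fieldType :=
  subfield (GRing.DivringClosed.clone {fraction coord_ring} degree0 _).

(* p/q as an element of the function field; the default value 0 is taken when *)
(* this fraction is not in the function field.                                 *)
Definition ffrac p q : function_field :=
  insubd (0 : subfield _) (coord_frac p q).

Definition ff_const (c : C) : function_field := ffrac c%:MP 1.

End FunctionField.

Notation tofrac := (@FracField.tofrac _).

(* C(z) is {fraction {poly C}}.                                                *)
Definition ratC (C : fieldType) (c : C) : {fraction {poly C}} := tofrac c%:P.
Definition ratz (C : fieldType) : {fraction {poly C}} := tofrac 'X.

Section Curve.
Variables (C : fieldType) (n : nat) (I : prime_idealr {mpoly C[n]}).

(* Dimension one: the function field has transcendence degree one over C, i.e. *)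
(* it is algebraic over a subfield isomorphic to C(t) over C.                  *)
Definition irreducible_curve : Prop :=
  irreducible_closed I /\
  exists tau : {rmorphism {fraction {poly C}} -> function_field I},
    (forall c, tau (ratC c) = ff_const I c) /\ (forall u, algebraicOver tau u).

Variables (gT : finGroupType) (G : {group gT}) (rG : mx_representation C G n).

Definition stable_variety : Prop :=
  forall x p, x \in G -> p \in I -> sym_act (rG x) p \in I.

(* u is fixed by the action p/q |-> (x p)/(x q) of G on the function field,    *)
(* which factors through the image of G in PGL(V).                             *)
Definition ff_invariant (u : function_field I) : Prop :=
  forall x, x \in G ->
  forall d p q, p \is d.-homog -> q \is d.-homog -> q \notin I ->
    u = ffrac I p q -> ffrac I (sym_act (rG x) p) (sym_act (rG x) q) = u.

(* An identification of C(z) with the function field of the quotient of the    *)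
(* variety by the image of G in PGL(V).                                        *)
Definition quotient_identification
    (theta : {rmorphism {fraction {poly C}} -> function_field I}) : Prop :=
  (forall c, theta (ratC c) = ff_const I c) /\
  (forall u, ff_invariant u <-> exists r, theta r = u).

(* Branch points when n = 2 and I = 0: the point z = (s : t) of P^1 is a       *)
(* branch point iff its fibre t A - s B = 0 has a multiple point, where        *)
(* z = A/B in lowest terms.  The points of P(V) are the nonzero linear forms   *)
(* up to scalars.                                                              *)
Definition branch_point (A B : {mpoly C[n]}) (s t : C) : Prop :=
  exists v q, v != 0 /\ t *: A - s *: B = lin v ^+ 2 * q.

Definition branched_at_0_1_oo
    (theta : {rmorphism {fraction {poly C}} -> function_field I}) : Prop :=
  exists d A B,
    [/\ A \is d.-homog, B \is d.-homog, B \notin I & theta (ratz C) = ffrac I A B] /\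
    (forall q a b, A = q * a -> B = q * b -> (msize q <= 1)%N) /\
    (forall s t, (s, t) != (0, 0) ->
       branch_point A B s t <-> [\/ s = 0, s = t | t = 0]).

End Curve.

Section DifferentialOperators.
Variables (C K : fieldType) (iota : {rmorphism {fraction {poly C}} -> K}).
Variable D : K -> K.

Definition cst (c : C) : K := iota (ratC c).

(* By the Leibniz rule, the last condition forces D to be d/dz on all of C(z). *)
Definition extends_ddz : Prop :=
  [/\ forall x y, D (x + y) = D x + D y,
      forall x y, D (x * y) = D x * y + x * D y
    & forall p : {poly C}, D (iota (tofrac p)) = iota (tofrac p^`())].

Definition galois_aut (s : {rmorphism K -> K}) : Prop :=
  bijective s /\ forall r, s (iota r) = iota r.

Definition galois_stable (W : K -> Prop) : Prop :=
  forall s, galois_aut s -> forall y, W y -> W (s y).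

(* L : {poly K} stands for the operator \sum_i L`_i (d/dz)^i, coefficients on  *)
(* the left.  The product of {poly K} is not the product of operators.         *)
Definition op_eval (L : {poly K}) (y : K) : K :=
  \sum_(i < size L) L`_i * iter i D y.

Definition solution (L : {poly K}) (y : K) : Prop := op_eval L y = 0.

(* (d/dz + a) o Q, and the substitution d/dz |-> d/dz + a in an operator.      *)
Definition op_mul_shift (a : K) (Q : {poly K}) : {poly K} :=
  'X * Q + map_poly D Q + a *: Q.

Definition op_shift (a : K) (L : {poly K}) : {poly K} :=
  \sum_(i < size L) L`_i *: iter i (op_mul_shift a) 1.

Definition monic_op (n : nat) (L : {poly K}) : Prop :=
  L \is monic /\ size L = n.+1.

Definition standard_operator (n : nat) (W : K -> Prop)
    (Lst : {poly {fraction {poly C}}}) : Prop :=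
  exists (L : {poly K}) (h : K),
    [/\ monic_op n L,
        forall y, solution L y <-> W y,
        h != 0,
        map_poly iota Lst = op_shift (D h / h) L
      & Lst`_n.-1 = 0].

Section Basis.
Variables (n : nat) (b : 'I_n -> K).

Definition is_basis (M : K -> Prop) : Prop :=
  (forall y, M y <-> exists v : 'rV[C]_n, y = \sum_(i < n) cst (v 0 i) * b i) /\
  (forall v : 'rV[C]_n, \sum_(i < n) cst (v 0 i) * b i = 0 -> v = 0).

(* The image of the Galois group in GL(M), in the basis b of M; matrices act   *)
(* on row vectors of coordinates.                                              *)
Definition diff_galois_group (A : 'M[C]_n) : Prop :=
  exists s, galois_aut s /\ forall i, s (b i) = \sum_(j < n) cst (A i j) * b j.

(* The ideal of the Fano curve in Sym(M), identified with {mpoly C[n]} by the  *)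
(* basis b of the solution space M; mmap cst b is then the morphism extending  *)
(* the inclusion of M.                                                         *)
Definition fano_ideal (p : {mpoly C[n]}) : Prop :=
  if n == 2%N then p = 0
  else ideal_generated
         (fun q => (exists d, q \is d.-homog) /\ mmap cst b q = 0) p.

End Basis.

(* The space f . V/l, for an embedding e of the function field in K.           *)
Definition twisted_space (n : nat) (I : prime_idealr {mpoly C[n]})
    (e : {rmorphism function_field I -> K}) (f : K) (l : 'rV[C]_n) (y : K) : Prop :=
  exists v : 'rV[C]_n, y = f * e (ffrac I (lin v) (lin l)).

End DifferentialOperators.

(* The preimage in the matrices of the image of S in PGL.                      *)
Definition projective_image (C : fieldType) (n : nat) (S : 'M[C]_n -> Prop)
    (A : 'M[C]_n) : Prop :=
  exists B c, [/\ S B, c != 0 & A = c *: B].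

(* Main.v *)
Require Import Defs.
From HB Require Import structures.
From mathcomp Require Import all_boot all_order all_algebra all_fingroup.
From mathcomp Require Import generic_quotient ring_quotient fraction mxrepresentation.
From mathcomp Require Import boolp ring.
From mathcomp Require classical_sets.

Set Implicit Arguments.
Unset Strict Implicit.
Unset Printing Implicit Defensive.

Import GRing.Theory.
Local Open Scope ring_scope.

(** Put [w i = f X_i/l], a basis of [W].  By the theory of the Wronskian there
    is exactly one monic operator [L] of order [n] that vanishes on [W], and its
    solution space is [W] ([monic_op_exists], [monic_op_unique],
    [monic_op_solution]).  The shift by [h'/h] is conjugation by [h], so it
    replaces the solution space by [h^-1 W] ([solution_shift]); it adds [n h'/h]
    to the coefficient of order [n - 1] ([op_shift_coefs]), which by Abel's
    formula ([abel]) becomes zero when [h^n] is the Wronskian of [W].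

    Everything rests on one rigidity statement ([standard_form_unique]): if two
    operators without term of order [n - 1] have solution spaces [M] and [m M],
    then they are conjugate by [m], hence [n m'/m = 0], hence [m] is a constant
    and the operators are equal.  Two choices of [l] and [f] give spaces [W] that
    differ by a factor, which is (1).  An element [s] of the Galois group of [K]
    over [C(z)] sends [h^-1 W] to [s(h)^-1 W], so it fixes the operator, whose
    coefficients are therefore in [C(z)] ([aut_fixed]).  (2) holds with
    [g = h^-1].  For (3), the Wronskian of the standard operator has derivative
    zero, so it is in [C] and is fixed by [s]; but [s] multiplies it by the
    determinant of its matrix ([det_galois_group]).

    For (4), [C(Z)] is a Galois extension of [C(z)] with group [G^p].  So the
    action of [x] in [G] on [C(Z)] extends to an automorphism of [K]
    ([aut_lift]), and conversely each [s] acts on the functions [X_i/l] as some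
    [x] in [G] ([aut_on_functions]).  In both cases the matrix of [s] on the
    solution space is the matrix of [x] times some [m] in [K]; both matrices have
    entries in [C], so [m] is an eigenvalue of a matrix over [C], and it lies in
    [C] ([scalar_twist]).  Finally a form [p] of degree [d] takes the value
    [(g f)^d p/l^d] at the basis of the solution space, which is zero exactly
    when [p] is in [I] ([mmap_basis]); and [I] is generated by its forms.

    The automorphisms of [K] come from Zorn's lemma ([extend_to_aut]).  They
    commute with the derivation, and the constants of [K] are those of [C],
    because [K] is algebraic over [C(z)] ([aut_ddz], [ddz_eq0]). *)

(** * Polynomials in one variable *)

Lemma exists_min_size (R : nzRingType) (P : {poly R} -> Prop) :
  (exists p, P p) ->
  exists2 p, P p & forall q, P q -> (size p <= size q)%N.
Proof.
move=> [p0 Pp0].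
have exk : exists k, `[< exists2 p, P p & size p = k >].
  by exists (size p0); apply/asboolP; exists p0.
case: (ex_minnP exk) => k /asboolP[p Pp <-] pmin; exists p => // q Pq.
by apply: pmin; apply/asboolP; exists q.
Qed.

Lemma deriv_neq0 (R : idomainType) (charR : [pchar R] =i pred0) (p : {poly R}) :
  (1 < size p)%N -> p^`() != 0.
Proof.
move=> p1; apply/eqP=> /(congr1 (fun q : {poly R} => q`_(size p).-2)).
have p0 : p != 0 by rewrite -size_poly_gt0 ltnW.
move/eqP; rewrite coef_deriv coef0 -mulr_natr mulf_eq0.
move/pcharf0P: charR => ->; rewrite prednK ?ltn_predRL // -lead_coefE.
by rewrite lead_coef_eq0 (negbTE p0) orFb; case: (size p) p1 => [|[]].
Qed.

Lemma natr_root_eq0 (R : idomainType) (charR : [pchar R] =i pred0) (p : {poly R}) :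
  (forall c : nat, root p c%:R) -> p = 0.
Proof.
move=> pr; apply/eqP/negP => /negP p0.
have inj : injective (fun c : nat => c%:R : R).
  move=> c d /eqP; wlog lecd : c d / (c <= d)%N.
    by move=> H; case: (leqP c d) => [/H//|/ltnW/H]; rewrite eq_sym => E /E.
  rewrite eq_sym -subr_eq0 -natrB //; move/pcharf0P: charR => ->.
  by rewrite subn_eq0 => ledc; apply/eqP; rewrite eqn_leq lecd.
have := @max_poly_roots _ p [seq c%:R | c <- iota 0 (size p)] p0.
rewrite map_inj_uniq ?iota_uniq // size_map size_iota ltnn => H.
by apply: (notF (H _ isT)); apply/allP => _ /mapP[c _ ->].
Qed.

Lemma size_cancel_lead (R : nzRingType) (p q : {poly R}) : p \is monic ->
  (size p <= size q)%N ->
  (size (q - (lead_coef q)%:P * 'X^(size q - size p) * p)%R < size q)%N.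
Proof.
move=> pm le_pq; have p0 : (0 < size p)%N by rewrite size_poly_gt0 monic_neq0.
have q0 : q != 0 by rewrite -size_poly_gt0 (leq_trans p0).
set m := (size q - size p)%N; set r := _ * p.
have Mnz : (lead_coef q)%:P * 'X^m != 0.
  rewrite -size_poly_gt0 size_mulXn ?polyC_eq0 ?lead_coef_eq0 // size_polyC.
  by rewrite lead_coef_eq0 q0 addn1.
have sr : size r = size q.
  rewrite size_Mmonic // size_mulXn ?polyC_eq0 ?lead_coef_eq0 // size_polyC.
  by rewrite lead_coef_eq0 q0 addn1 addSn /= subnK.
have lr : lead_coef r = lead_coef q.
  by rewrite !lead_coef_Mmonic ?lead_coefC ?monicXn.
rewrite -[X in (_ < X)%N](prednK (leq_trans p0 le_pq)) ltnS.
apply/leq_sizeP => j; rewrite leq_eqVlt coefB => /orP[/eqP<-|ltj].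
  by rewrite -{2}sr -!lead_coefE lr subrr.
by rewrite !nth_default ?subrr // ?sr -(prednK (leq_trans p0 le_pq)).
Qed.

(** * Automorphisms of an algebraically closed algebraic extension *)

Section AlgebraicExtension.
Variables (F : fieldType) (K : closedFieldType) (iota : {rmorphism F -> K}).
Hypothesis charF : [pchar F] =i pred0.
Hypothesis K_alg : forall x, algebraicOver iota x.

Local Notation "p ^i" := (map_poly iota p) (at level 2, format "p ^i").

Lemma exists_minpoly y : exists p : {poly F},
  [/\ p \is monic, root p^i y
    & forall q, root q^i y -> (size q < size p)%N -> q = 0].
Proof.
have [p0 p0nz rp0] := K_alg y.
case: (@exists_min_size F (fun p => p != 0 /\ root p^i y)) => [|p [pnz rp] pmin].
  by exists p0.
have lp : (lead_coef p)^-1 != 0 by rewrite invr_eq0 lead_coef_eq0.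
exists ((lead_coef p)^-1 *: p); split.
- by rewrite monicE lead_coefZ mulVf ?lead_coef_eq0.
- by rewrite map_polyZ rootZ ?fmorph_eq0.
move=> q rq; rewrite size_scale // => lt_qp; apply/eqP/negP => /negP q0.
by have := pmin q (conj q0 rq); rewrite leqNgt lt_qp.
Qed.

Section MinimalPolynomial.
Variables (y : K) (p : {poly F}).
Hypotheses (p_monic : p \is monic) (p_root : root p^i y).
Hypothesis p_min : forall q, root q^i y -> (size q < size p)%N -> q = 0.

Lemma minpoly_dvd (q : {poly F}) : root q^i y -> p %| q.
Proof.
move=> rq; apply/eqP/p_min; last by rewrite ltn_modp monic_neq0.
move: rq; rewrite {1}(divp_eq q p) rmorphD rmorphM /= /root !hornerE.
by rewrite (rootP p_root) mulr0 add0r.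
Qed.

Lemma minpoly_size : (1 < size p)%N.
Proof.
rewrite ltnNge; apply/negP=> /size1_polyC p1.
move: p_root p_monic; rewrite p1 map_polyC rootC fmorph_eq0 => /eqP->.
by rewrite monicE lead_coef0 eq_sym oner_eq0.
Qed.

Lemma minpoly_separable : ~~ root (p^`())^i y.
Proof.
apply/negP=> /p_min dp0.
have /eqP[] := deriv_neq0 charF minpoly_size.
by apply: dp0; apply: lt_size_deriv; rewrite monic_neq0.
Qed.

End MinimalPolynomial.

(** A partial automorphism of K over F is encoded by its graph, a subring of
    K x K: unions of chains and polynomials with coefficients in the graph then
    need no transport between domains. *)
Record partial_aut (S : K * K -> Prop) : Prop := PartialAut {
  pa_base : forall r, S (iota r, iota r);
  pa_sub : forall u v, S u -> S v -> S (u - v);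
  pa_mul : forall u v, S u -> S v -> S (u * v);
  pa_fun : forall u, S u -> u.1 = 0 -> u = 0 }.

Section PartialAut.
Variable S : K * K -> Prop.
Hypothesis S_pa : partial_aut S.

Let S0 : S 0.
Proof. by have := pa_base S_pa 0; rewrite rmorph0. Qed.
Let S1 : S 1.
Proof. by have := pa_base S_pa 1; rewrite rmorph1. Qed.
Let SN u : S u -> S (- u).
Proof. by move=> Su; rewrite -sub0r; apply: (pa_sub S_pa). Qed.
Let SD u v : S u -> S v -> S (u + v).
Proof. by move=> Su Sv; rewrite -[v]opprK; apply: (pa_sub S_pa) => //; exact: SN. Qed.

Let S_inj u v : S u -> S v -> u.1 = v.1 -> u = v.
Proof.
move=> Su Sv uv; apply/eqP; rewrite -subr_eq0; apply/eqP/(pa_fun S_pa).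
  exact: (pa_sub S_pa).
by rewrite /= uv subrr.
Qed.

Lemma pa_horner (q : {poly F}) u : S u -> S (q^i.[u.1], q^i.[u.2]).
Proof.
move=> Su; elim/poly_ind: q => [|q c IH]; first by rewrite rmorph0 !horner0.
rewrite rmorphD rmorphM /= map_polyX map_polyC !hornerE.
exact: (SD (pa_mul S_pa IH Su) (pa_base S_pa c)).
Qed.

(** The domain is a subfield because F[a] is one: with c0 + a q(a) = 0 the
    minimal equation of a, the inverse of a is - q(a) / c0. *)
Lemma pa_inv u : S u -> u != 0 -> exists2 v, S v & u * v = 1.
Proof.
move=> Su u0; have [p [pm pr pmin]] := exists_minpoly u.1.
have u10 : u.1 != 0 by apply: contra u0 => /eqP/(pa_fun S_pa Su)->.
pose c := p.[0]; pose q := p %/ 'X.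
have def_p : p = q * 'X + c%:P.
  by have := divp_eq p ('X - 0%:P); rewrite modp_XsubC polyC0 subr0.
have c0 : c != 0.
  apply/eqP=> c0; have q0 : q = 0.
    apply: pmin; last first.
      have qnz : q != 0.
        apply: contraTneq (monic_neq0 pm) => q0.
        by rewrite def_p q0 c0 mul0r addr0 eqxx.
      by rewrite def_p c0 addr0 size_mulX.
    move: pr; rewrite {1}def_p c0 addr0 rmorphM /= map_polyX /root !hornerE.
    by rewrite mulf_eq0 (negbTE u10) orbF.
  by move: (monic_neq0 pm); rewrite def_p q0 c0 mul0r addr0 eqxx.
pose v := (iota (- c^-1), iota (- c^-1)) * (q^i.[u.1], q^i.[u.2]) : K * K.
have Sv : S v by apply: (pa_mul S_pa); [exact: (pa_base S_pa) | exact: pa_horner].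
exists v => //; apply: S_inj; rewrite //=; first exact: (pa_mul S_pa).
move/rootP: pr; rewrite {1}def_p rmorphD rmorphM /= map_polyX map_polyC !hornerE.
move/eqP; rewrite addr_eq0 => /eqP E.
rewrite -[LHS]/(u.1 * iota (- c^-1) * q^i.[u.1]) mulrAC [u.1 * _]mulrC E.
by rewrite -rmorphN -rmorphM mulrNN divff // rmorph1.
Qed.

Definition graph_coefs (P : {poly K * K}) : Prop := forall i, S P`_i.

Local Notation fst_poly P := (map_poly (@fst K K) P).
Local Notation snd_poly P := (map_poly (@snd K K) P).

Lemma graph_coefsB P Q : graph_coefs P -> graph_coefs Q -> graph_coefs (P - Q).
Proof. by move=> hP hQ i; rewrite coefB; apply: (pa_sub S_pa). Qed.

Lemma graph_coefsM P Q : graph_coefs P -> graph_coefs Q -> graph_coefs (P * Q).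
Proof.
by move=> hP hQ i; rewrite coefM; apply: (big_ind S) => // j _; apply: (pa_mul S_pa).
Qed.

Lemma graph_coefsC u : S u -> graph_coefs u%:P.
Proof. by move=> Su i; rewrite coefC; case: eqP. Qed.

Lemma graph_coefsXn k : graph_coefs 'X^k.
Proof. by move=> i; rewrite coefXn; case: eqP. Qed.

(** Among the non-zero polynomials over the graph whose first component vanishes at x,
    let P be one of least degree, made monic; y is a root of the second component
    of P.  Every other such polynomial is a multiple of P, so its second
    component vanishes at y: the graph of P(x) |-> P(y) is functional. *)
Lemma pa_extend (x : K) : exists S' : K * K -> Prop,
  [/\ partial_aut S', forall u, S u -> S' u & exists y, S' (x, y)].
Proof.
have [p [pm pr _]] := exists_minpoly x.
case: (@exists_min_size _ (fun P => [/\ graph_coefs P, P != 0 & root (fst_poly P) x])).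
  (* The minimal polynomial of x over F, read over the diagonal of F. *)
  pose d r := (iota r, iota r) : K * K.
  exists (\poly_(i < size p) d p`_i); split.
  - by move=> i; rewrite coef_poly; case: ifP => // _; apply: (pa_base S_pa).
  - apply/eqP=> /(congr1 (fun P : {poly K * K} => (P`_(size p).-1).1)).
    have ps : (0 < size p)%N by rewrite size_poly_gt0 monic_neq0.
    rewrite coef_poly prednK // leqnn coef0 /= -lead_coefE (monicP pm) rmorph1.
    by move/eqP; rewrite oner_eq0.
  - suff -> : fst_poly (\poly_(i < size p) d p`_i) = p^i by [].
    apply/polyP=> i; rewrite !coef_map coef_poly /=; case: ifP => //= /negbT.
    by rewrite -leqNgt => /leq_sizeP->; rewrite ?rmorph0.
move=> P1 [hP1 P1nz rP1] P1min.
have [v Sv uv] : exists2 v, S v & lead_coef P1 * v = 1.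
  by apply: pa_inv; [exact: hP1 | rewrite lead_coef_eq0].
pose P := v%:P * P1.
have hP : graph_coefs P by apply: graph_coefsM => //; apply: graph_coefsC.
have lP : P \is monic.
  have nz : v * lead_coef P1 != 0 by rewrite mulrC uv oner_eq0.
  by rewrite monicE /P lead_coef_proper_mul lead_coefC // mulrC uv.
have rP : root (fst_poly P) x.
  by rewrite rmorphM /= rootM rP1 orbT.
have Pmin Q : graph_coefs Q -> root (fst_poly Q) x -> (size Q < size P)%N -> Q = 0.
  move=> hQ rQ lt; apply/eqP/negP => /negP Qnz.
  have := P1min Q (And3 hQ Qnz rQ).
  have sP : (size P <= size P1)%N.
    rewrite /P mul_polyC; apply/leq_sizeP => j jP.
    by rewrite coefZ (leq_sizeP _ _ (leqnn _)) // mulr0.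
  by rewrite leqNgt (leq_trans lt).
have [y ry] : exists y, root (snd_poly P) y.
  apply/closed_rootP; have sm : snd_poly P \is monic by apply: monic_map.
  apply/negP=> /eqP s1.
  have sP : size P = size (snd_poly P).
    by rewrite size_map_poly_id0 // (monicP lP) oner_eq0.
  have sP' : size P = size (fst_poly P).
    by rewrite size_map_poly_id0 // (monicP lP) oner_eq0.
  have fm : fst_poly P \is monic by apply: monic_map.
  move: rP; have := size1_polyC (eq_leq (etrans (esym sP') (etrans sP s1))).
  move=> E; move: fm; rewrite E rootC monicE lead_coefC => /eqP->.
  by rewrite oner_eq0.
(* Division by P, by descending the degree of Q. *)
have key (Q : {poly K * K}) :
    graph_coefs Q -> root (fst_poly Q) x -> root (snd_poly Q) y.
  elim: {Q}(size Q).+1 {-2}Q (ltnSn (size Q)) => // k IH Q ltk hQ rQ.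
  have [ltQP|leQP] := ltnP (size Q) (size P).
    by rewrite (Pmin Q) // rmorph0 root0.
  pose m := (size Q - size P)%N; pose M := (lead_coef Q)%:P * 'X^m.
  have hM : graph_coefs M.
    by apply: graph_coefsM (graph_coefsXn m); apply/graph_coefsC/hQ.
  have hQ' : graph_coefs (Q - M * P) by apply: graph_coefsB (graph_coefsM _ _).
  have ltQ' : (size (Q - M * P)%R < k)%N.
    by rewrite -ltnS (leq_trans _ ltk) // ltnS size_cancel_lead.
  have rQ' : root (fst_poly (Q - M * P)) x.
    by rewrite rmorphB rmorphM /= /root !hornerE (rootP rP) (rootP rQ) mulr0 subr0.
  have := IH _ ltQ' hQ' rQ'.
  rewrite rmorphB rmorphM /= /root !hornerE (rootP ry) mulr0 subr0.
  by [].
pose S' u := exists2 P, graph_coefs P & u = ((fst_poly P).[x], (snd_poly P).[y]).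
exists S'; split.
- split.
  + move=> r; exists (iota r, iota r)%:P; first exact/graph_coefsC/(pa_base S_pa).
    by rewrite !map_polyC !hornerE.
  + move=> _ _ [P2 hP2 ->] [P3 hP3 ->]; exists (P2 - P3); first exact: graph_coefsB.
    by rewrite !rmorphB /= !hornerE.
  + move=> _ _ [P2 hP2 ->] [P3 hP3 ->]; exists (P2 * P3); first exact: graph_coefsM.
    by rewrite !rmorphM /= !hornerE.
  + move=> _ [P2 hP2 ->] /= r0; rewrite r0.
    by have /rootP-> := key _ hP2 (introT rootP r0).
- move=> u Su; exists u%:P; first exact: graph_coefsC.
  by rewrite !map_polyC !hornerE -surjective_pairing.
- by exists y, 'X; [exact: (graph_coefsXn 1) | rewrite !map_polyX !hornerE].
Qed.

End PartialAut.

Lemma partial_aut_bigcup (A : (K * K -> Prop) -> Prop) :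
  (exists S, A S) -> (forall S, A S -> partial_aut S) ->
  (forall S S', A S -> A S' -> (forall u, S u -> S' u) \/ (forall u, S' u -> S u)) ->
  partial_aut (fun u => exists2 S, A S & S u).
Proof.
move=> [S1 AS1] paA totA.
have both u v : (exists2 S, A S & S u) -> (exists2 S, A S & S v) ->
    exists S, [/\ A S, S u & S v].
  move=> [S AS Su] [S' AS' S'v]; have [SS'|S'S] := totA _ _ AS AS'.
    by exists S'; split=> //; apply: SS'.
  by exists S; split=> //; apply: S'S.
split.
- by move=> r; exists S1 => //; apply: (pa_base (paA _ AS1)).
- move=> u v hu hv; have [S [AS Su Sv]] := both _ _ hu hv.
  by exists S => //; apply: (pa_sub (paA _ AS)).
- move=> u v hu hv; have [S [AS Su Sv]] := both _ _ hu hv.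
  by exists S => //; apply: (pa_mul (paA _ AS)).
- by move=> u [S AS Su]; apply: (pa_fun (paA _ AS)).
Qed.

Lemma exists_total_partial_aut (S : K * K -> Prop) : partial_aut S ->
  exists T, [/\ partial_aut T, forall u, S u -> T u & forall x, exists y, T (x, y)].
Proof.
move=> paS.
pose good T := partial_aut T /\ (forall u, S u -> T u).
(* The empty graph is admitted because the empty chain has it as its union. *)
pose P (T : K * K -> Prop) := good T \/ (forall u, ~ T u).
have [|T [PT Tmax]] := @classical_sets.Zorn_bigcup (K * K)%type P.
  move=> A AP totA; have [[T AT gT]|noT] := pselect (exists2 T, A T & good T).
    left; have -> : classical_sets.bigcup A id =
                    fun u => exists2 T, (A T /\ good T) & T u.
      apply/funext=> u; apply/propext; split=> [[U AU Uu]|[U [AU _] Uu]].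
        by exists U => //; split=> //; have [//|/(_ u)] := AP _ AU.
      by exists U.
    split; last by move=> u Su; exists T => //; case: gT => _; apply.
    apply: partial_aut_bigcup; first by exists T.
      by move=> U [_ []].
    by move=> U V [AU _] [AV _]; apply: totA.
  right=> u [U AU Uu]; have [gU|/(_ u)//] := AP _ AU.
  by apply: noT; exists U.
have [paT ST] : good T.
  case: PT => // T0; exfalso; apply: (Tmax S); last by left; split.
  split; first by move=> u /T0.
  by move=> /(_ _ (pa_base paS 0)) /T0.
exists T; split=> // x; have [T' [paT' TT' [y T'xy]]] := pa_extend paT x.
exists y; apply: contrapT => nTxy; apply: (Tmax T').
  by split=> // /(_ _ T'xy).
by left; split=> // u /ST/TT'.
Qed.

(** The condition [galois_aut] over an arbitrary base field. *)
Definition alg_aut (s : {rmorphism K -> K}) : Prop :=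
  bijective s /\ forall r, s (iota r) = iota r.

(** An F-endomorphism of an algebraic extension is onto: it permutes the
    finitely many roots of a polynomial over F. *)
Lemma alg_endo_bij (s : {rmorphism K -> K}) :
  (forall r, s (iota r) = iota r) -> bijective s.
Proof.
move=> s_id; have s_inj : injective s := fmorph_inj s.
suff surj y : exists x, s x = y.
  have [t ts] := choice surj; exists t => // x.
  by apply: s_inj; rewrite ts.
have [p [pm pr _]] := exists_minpoly y.
have [rs def_p] := closed_field_poly_normal p^i.
have rsE z : (z \in undup rs) = root p^i z.
  rewrite mem_undup def_p (monicP (monic_map _ pm)) scale1r.
  by rewrite root_prod_XsubC.
have sub : {subset map s (undup rs) <= undup rs}.
  move=> _ /mapP[z + ->]; rewrite !rsE => rz.
  rewrite -[p^i](_ : map_poly s p^i = _) ?fmorph_root //.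
  by apply/polyP=> i; rewrite !coef_map /= s_id.
have uniq_map : uniq (map s (undup rs)) by rewrite map_inj_uniq ?undup_uniq.
have [|_ rs_im] := uniq_min_size uniq_map sub; first by rewrite size_map.
by move: (rs_im y); rewrite rsE pr => /mapP[x _ ->]; exists x.
Qed.

(** A maximal partial automorphism is defined everywhere, since otherwise
    [pa_extend] would enlarge it. *)
Lemma extend_to_aut (S : K * K -> Prop) : partial_aut S ->
  exists s : {rmorphism K -> K}, alg_aut s /\ forall u, S u -> s u.1 = u.2.
Proof.
move=> paS; have [T [paT ST totT]] := exists_total_partial_aut paS.
have Tuniq x y y' : T (x, y) -> T (x, y') -> y = y'.
  move=> Ty Ty'; apply/eqP; rewrite -subr_eq0; apply/eqP.
  have := pa_fun paT (pa_sub paT Ty Ty'); rewrite /= subrr => /(_ erefl).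
  by move/(congr1 snd).
have [s Ts] := choice totT.
have sB : zmod_morphism s.
  by move=> x y; apply: Tuniq (Ts _) _; apply: (pa_sub paT (Ts x) (Ts y)).
have sM : monoid_morphism s.
  split; first by apply: Tuniq (Ts _) _; have := pa_base paT 1; rewrite rmorph1.
  by move=> x y; apply: Tuniq (Ts _) _; apply: (pa_mul paT (Ts x) (Ts y)).
pose sr : {rmorphism K -> K} := HB.pack s
  (GRing.isZmodMorphism.Build _ _ s sB) (GRing.isMonoidMorphism.Build _ _ s sM).
have s_id r : sr (iota r) = iota r by apply: Tuniq (Ts _) (pa_base paT r).
exists sr; split; first by split=> //; apply: alg_endo_bij.
by case=> x y /ST Txy; apply: Tuniq (Ts _) Txy.
Qed.

(** The minimal polynomial of x is separable of degree at least two, so it has a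
    root y different from x, and q(x) |-> q(y) is a partial automorphism. *)
Lemma exists_aut_moving x : (forall r, x <> iota r) ->
  exists s : {rmorphism K -> K}, alg_aut s /\ s x <> x.
Proof.
move=> xF; have [p [pm pr pmin]] := exists_minpoly x.
have [q def_p] := factor_theorem _ _ pr.
have sq : (size q != 1)%N.
  apply/negP=> /eqP q1; have : size p = 2%N.
    rewrite -(size_map_poly iota) def_p size_Mmonic ?monicXsubC //.
      by rewrite q1 size_XsubC.
    by rewrite -size_poly_eq0 q1.
  move=> p2; apply: (xF (- p`_0)); rewrite rmorphN; apply/eqP; rewrite -addr_eq0 addrC.
  have : p`_1 = 1 by have := monicP pm; rewrite lead_coefE p2.
  move/rootP: pr; rewrite (@horner_coef_wide _ 2); last by rewrite size_map_poly p2.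
  rewrite big_ord_recl big_ord1 !coef_map /= expr0 expr1 mulr1 => /[swap] ->.
  by rewrite rmorph1 mul1r => ->.
have [y ry] := closed_rootP _ sq.
have pry : root p^i y by rewrite def_p rootM ry.
have yx : y <> x.
  move=> yx; have /negP[] := minpoly_separable pm pr pmin.
  rewrite -deriv_map def_p derivM derivXsubC mulr1 rootE !hornerE subrr mulr0 add0r.
  by rewrite -yx; move/rootP: ry ->.
pose S u := exists q : {poly F}, u = (q^i.[x], q^i.[y]).
have paS : partial_aut S.
  split.
  - by move=> r; exists r%:P; rewrite map_polyC !hornerE.
  - by move=> _ _ [q1 ->] [q2 ->]; exists (q1 - q2); rewrite rmorphB !hornerE.
  - by move=> _ _ [q1 ->] [q2 ->]; exists (q1 * q2); rewrite rmorphM !hornerE.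
  - move=> _ [q1 ->] /= q1x; rewrite q1x.
    have /dvdpP[q2 ->] := minpoly_dvd pm pr pmin (introT rootP q1x).
    by rewrite rmorphM hornerM (rootP pry) mulr0.
have [s [s_aut sS]] := extend_to_aut paS; exists s; split=> //.
have Sxy : S (x, y) by exists 'X; rewrite map_polyX !hornerX.
by rewrite (sS _ Sxy).
Qed.

Lemma aut_fixed x : (forall s, alg_aut s -> s x = x) -> exists r, x = iota r.
Proof.
move=> fx; apply: contrapT => nx.
have [|s [s_aut sx]] := @exists_aut_moving x; last exact/sx/fx.
by move=> r xr; apply: nx; exists r.
Qed.

End AlgebraicExtension.

(** * Derivations, and the constants of an algebraic extension of C(z) *)

Lemma fraction_quotient (R : idomainType) (r : {fraction R}) :
  exists a b, b != 0 /\ r = tofrac a / tofrac b.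
Proof.
elim/quotW: r => x; exists x.1, x.2; have x2 := denom_ratioP x.
split=> //; apply: (canRL (mulfK _)); first by rewrite tofrac_eq0.
unlock FracField.tofrac; rewrite -[LHS]FracField.pi_mul.
rewrite /FracField.mulf !numden_Ratio ?oner_neq0 // mulr1.
apply/eqmodP; rewrite /= FracField.equivfE !numden_Ratio ?oner_neq0 //.
by rewrite mulr1 mulrC.
Qed.

Section Derivation.
Variables (K : fieldType) (D : K -> K).

Record derivation : Prop := Derivation {
  derivationD : forall x y, D (x + y) = D x + D y;
  derivationM : forall x y, D (x * y) = D x * y + x * D y }.

Hypothesis dD : derivation.

Lemma derivation0 : D 0 = 0.
Proof. by apply: (addrI (D 0)); rewrite -(derivationD dD) !addr0. Qed.

Lemma derivation1 : D 1 = 0.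
Proof.
by apply: (addrI (D 1)); rewrite addr0 -{3}[1]mulr1 (derivationM dD) mulr1 mul1r.
Qed.

Lemma derivationN x : D (- x) = - D x.
Proof.
by apply: (addrI (D x)); rewrite -(derivationD dD) !subrr derivation0.
Qed.

Lemma derivationV x : x != 0 -> D x^-1 = - D x / x ^+ 2.
Proof.
move=> x0; have /eqP := derivationM dD x x^-1; rewrite divff // derivation1.
rewrite eq_sym addr_eq0 => /eqP E; rewrite expr2 invfM mulrA mulNr E opprK.
by rewrite mulrC mulKf.
Qed.

Lemma derivation_sum I (r : seq I) (P : pred I) (f : I -> K) :
  D (\sum_(i <- r | P i) f i) = \sum_(i <- r | P i) D (f i).
Proof. exact: (big_morph D (derivationD dD) derivation0). Qed.

Lemma derivation_prod (I : finType) (f : I -> K) :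
  D (\prod_i f i) = \sum_i D (f i) * \prod_(j | j != i) f j.
Proof.
have H (r : seq I) : uniq r -> D (\prod_(i <- r) f i) =
    \sum_(i <- r) D (f i) * \prod_(j <- r | j != i) f j.
  elim: r => [|i r IH] /=; first by rewrite !big_nil derivation1.
  case/andP=> nir ur; rewrite !big_cons (derivationM dD) eqxx IH //.
  congr (_ + _).
    rewrite big_seq [in RHS]big_seq_cond; congr (_ * _); apply: eq_bigl => j.
    by apply/idP/andP=> [jr|[]//]; split=> //; apply: contraNneq nir => <-.
  rewrite big_distrr !big_seq /=; apply: eq_bigr => j jr.
  rewrite big_cons ifT; first by rewrite mulrCA.
  by apply: contraNneq nir => ->.
by rewrite H ?index_enum_uniq.
Qed.

Lemma derivation_exp x i :
  D (x ^+ i.+1) = i.+1%:R * x ^+ i * D x.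
Proof.
elim: i => [|i IH]; first by rewrite expr0 expr1 !mul1r.
rewrite exprS (derivationM dD) IH [i.+2%:R]mulrS mulrDl mul1r mulrDl exprS.
by rewrite [D x * _]mulrC [x * (_ * _)]mulrA [x * (_ * _)]mulrCA.
Qed.

Lemma derivation_horner (q : {poly K}) y :
  D q.[y] = (map_poly D q).[y] + q^`().[y] * D y.
Proof.
have mapD p c : map_poly D (p * 'X + c%:P) = map_poly D p * 'X + (D c)%:P.
  apply/polyP=> i; rewrite coef_map_id0 ?derivation0 // !coefD !coefMX !coefC.
  rewrite (derivationD dD) coef_map_id0 ?derivation0 //.
  by case: (i == 0)%N; rewrite ?derivation0.
elim/poly_ind: q => [|q c IH].
  rewrite (_ : map_poly D 0 = 0); last exact: map_poly0.
  by rewrite deriv0 !horner0 derivation0 mul0r addr0.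
rewrite mapD derivMXaddC !hornerE (derivationD dD) (derivationM dD) IH.
ring.
Qed.

End Derivation.

(** In lowest terms, a' b = a b' makes b divide b', which is of smaller degree;
    so b' = 0, and then a' = 0. *)
Lemma deriv_quotient_const (C : fieldType) (charC : [pchar C] =i pred0)
    (a b : {poly C}) :
  b != 0 -> a^`() * b = a * b^`() -> exists c, tofrac a / tofrac b = ratC c.
Proof.
move=> b0 ab; pose g := gcdp a b; have g0 : g != 0 by rewrite gcdp_eq0 negb_and b0 orbT.
have [a1 def_a] : exists a1, a = a1 * g by apply/dvdpP/dvdp_gcdl.
have [b1 def_b] : exists b1, b = b1 * g by apply/dvdpP/dvdp_gcdr.
have b10 : b1 != 0 by apply: contraNneq b0 => b10; rewrite def_b b10 mul0r.
have cop : coprimep a1 b1.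
  have -> : a1 = a %/ g by rewrite def_a mulpK.
  have -> : b1 = b %/ g by rewrite def_b mulpK.
  by apply: coprimep_div_gcd; rewrite b0 orbT.
have ab1 : a1^`() * b1 = a1 * b1^`().
  have g20 : g ^+ 2 != 0 by rewrite expf_neq0.
  apply: (mulIf g20); move: ab; rewrite def_a def_b !derivM => ab.
  have := congr1 (fun x => x - a1 * g * (b1 * g^`())) ab.
  by rewrite (_ : _ - _ = a1^`() * b1 * g ^+ 2) => [->|]; ring.
have const p : p^`() = 0 -> exists c : C, p = c%:P.
  move=> dp; have [s1|/deriv_neq0] := leqP (size p) 1.
    by exists p`_0; apply: size1_polyC.
  by move=> /(_ charC); rewrite dp eqxx.
have db1 : b1^`() = 0.
  apply: contraTeq cop => db1.
  have : b1 %| b1^`() * a1 by rewrite mulrC -ab1 dvdp_mull.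
  rewrite coprimep_sym; apply: contraTN => cop; rewrite Gauss_dvdpl //.
  by apply/negP=> /(dvdp_leq db1); rewrite leqNgt lt_size_deriv.
have da1 : a1^`() = 0.
  by move/eqP: ab1; rewrite db1 mulr0 mulf_eq0 (negbTE b10) orbF => /eqP.
have [[c def_a1] [d def_b1]] := (const _ da1, const _ db1); exists (c / d).
have d0 : d != 0 by move: b10; rewrite def_b1 polyC_eq0.
rewrite def_a def_b !tofracM -mulf_div divff ?tofrac_eq0 // mulr1 def_a1 def_b1.
apply: (canLR (mulfK _)); first by rewrite tofrac_eq0 polyC_eq0.
by rewrite /ratC -tofracM -polyCM divfK.
Qed.

Section RationalDerivation.
Variables (C K : closedFieldType) (iota : {rmorphism {fraction {poly C}} -> K}).
Hypothesis charC : [pchar C] =i pred0.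
Hypothesis K_alg : forall x, algebraicOver iota x.
Variable D : K -> K.
Hypothesis D_ddz : extends_ddz iota D.

Lemma ddz_derivation : derivation D.
Proof. by case: D_ddz. Qed.

Lemma ratC_is_zmod_morphism : zmod_morphism (@ratC C).
Proof. by move=> x y; rewrite /ratC polyCB tofracB. Qed.

Lemma ratC_is_monoid_morphism : monoid_morphism (@ratC C).
Proof. by split=> [|x y]; rewrite /ratC ?polyCM ?tofracM ?polyC1 ?tofrac1. Qed.

Lemma cst_is_zmod_morphism : zmod_morphism (cst iota).
Proof. by move=> x y; rewrite /cst ratC_is_zmod_morphism rmorphB. Qed.

Lemma cst_is_monoid_morphism : monoid_morphism (cst iota).
Proof.
case: ratC_is_monoid_morphism => r1 rM.
by split=> [|x y]; rewrite /cst ?r1 ?rM ?rmorph1 ?rmorphM.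
Qed.

HB.instance Definition _ :=
  GRing.isZmodMorphism.Build C K (cst iota) cst_is_zmod_morphism.
HB.instance Definition _ :=
  GRing.isMonoidMorphism.Build C K (cst iota) cst_is_monoid_morphism.

Lemma char_ratfun : [pchar {fraction {poly C}}] =i pred0.
Proof.
apply/pcharf0P => n; rewrite -tofrac1 -raddfMn /= tofrac_eq0 -polyC1 -raddfMn /=.
by rewrite polyC_eq0; move/pcharf0P: charC ->.
Qed.

Lemma char_K : [pchar K] =i pred0.
Proof. by move=> p; rewrite -char_ratfun; apply: (fmorph_pchar iota). Qed.

Lemma root_over_C (p : {poly C}) y :
  p != 0 -> root (map_poly (cst iota) p) y -> exists c, y = cst iota c.
Proof.
move=> p0; have [rs ->] := closed_field_poly_normal p.
rewrite map_polyZ rootZ ?fmorph_eq0 ?lead_coef_eq0 // rmorph_prod /=.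
rewrite rootE horner_prod prodf_seq_eq0 => /hasP[c _].
rewrite /= rmorphB /= map_polyX map_polyC /= !hornerE subr_eq0 => /eqP->.
by exists c.
Qed.

Lemma ddz_iota r : exists t, D (iota r) = iota t.
Proof.
have [_ _ Dp] := D_ddz; have dD := ddz_derivation.
have [a [b [b0 ->]]] := fraction_quotient r; rewrite fmorph_div.
have b0' : iota (tofrac b) != 0 by rewrite fmorph_eq0 tofrac_eq0.
rewrite (derivationM dD) (derivationV dD) // !Dp.
rewrite -rmorphN -rmorphXn -!fmorphV -!rmorphM -rmorphD /=.
by eexists.
Qed.

Lemma ddz_iota_eq0 r : D (iota r) = 0 -> exists c, r = ratC c.
Proof.
have [_ _ Dp] := D_ddz; have dD := ddz_derivation.
have [a [b [b0 ->]]] := fraction_quotient r; rewrite fmorph_div.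
have b0' : iota (tofrac b) != 0 by rewrite fmorph_eq0 tofrac_eq0.
rewrite (derivationM dD) (derivationV dD) // !Dp => E.
apply: deriv_quotient_const => //; apply/eqP; rewrite -tofrac_eq -(fmorph_eq iota).
rewrite -subr_eq0 !tofracM !rmorphM /=.
have -> : iota (tofrac a^`()) * iota (tofrac b) - iota (tofrac a) * iota (tofrac b^`())
  = (iota (tofrac a^`()) / iota (tofrac b)
     + iota (tofrac a) * (- iota (tofrac b^`()) / iota (tofrac b) ^+ 2))
    * iota (tofrac b) ^+ 2 by field.
by rewrite E mul0r.
Qed.

Lemma ddz_cst c : D (cst iota c) = 0.
Proof.
have [_ _ Dp] := D_ddz.
by rewrite /cst /ratC Dp derivC tofrac0 rmorph0.
Qed.

(** Differentiating the minimal equation of a constant y gives an equation for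
    y of smaller degree; hence the coefficients of the first are constants of
    C(z), that is, elements of C, and C is algebraically closed. *)
Lemma ddz_eq0 y : D y = 0 -> exists c, y = cst iota c.
Proof.
move=> Dy; have dD := ddz_derivation.
have [p [pm pr pmin]] := exists_minpoly K_alg y.
have [delta deltaP] := choice ddz_iota.
have delta0 : delta 0 = 0.
  by apply: (fmorph_inj iota); rewrite -deltaP rmorph0 derivation0.
have delta1 : delta 1 = 0.
  by apply: (fmorph_inj iota); rewrite -deltaP rmorph1 rmorph0 derivation1.
have dp0 : map_poly delta p = 0.
  apply: pmin.
    have := derivation_horner dD (map_poly iota p) y.
    rewrite (rootP pr) derivation0 // Dy mulr0 addr0 => E.
    apply/rootP; rewrite [in RHS]E; congr _.[_]; apply/polyP=> i.
    by rewrite !coef_map_id0 ?rmorph0 ?delta0 ?derivation0 // deltaP.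
  have p1 : (0 < size p)%N by rewrite size_poly_gt0 monic_neq0.
  rewrite -[X in (_ < X)%N](prednK p1) ltnS; apply/leq_sizeP => j.
  rewrite coef_map_id0 // leq_eqVlt => /orP[/eqP<-|ltj].
    by rewrite -lead_coefE (monicP pm) delta1.
  by rewrite nth_default // -(prednK p1).
have coefC i : exists c, p`_i = ratC c.
  apply: ddz_iota_eq0; rewrite deltaP -(coef_map_id0 _ _ delta0) dp0 coef0.
  by rewrite rmorph0.
have [c cP] := choice coefC.
have def_p : map_poly iota p = map_poly (cst iota) (\poly_(i < size p) c i).
  apply/polyP=> i; rewrite !coef_map coef_poly; case: ifP => [_|/negbT].
    by rewrite cP.
  by rewrite -leqNgt /= => /leq_sizeP->; rewrite // !rmorph0.
apply: (@root_over_C (\poly_(i < size p) c i)); last by rewrite -def_p.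
by rewrite -(map_poly_eq0 (cst iota)) -def_p map_poly_eq0 monic_neq0.
Qed.

(** The derivation of an algebraic extension is determined by its restriction to
    C(z): the derivative of y is forced by differentiating the minimal equation
    of y, which is separable. *)
Lemma aut_ddz (s : {rmorphism K -> K}) : galois_aut iota s ->
  forall y, s (D y) = D (s y).
Proof.
move=> [_ s_id] y; have dD := ddz_derivation.
have [p [pm pr pmin]] := exists_minpoly K_alg y.
have psep := minpoly_separable char_ratfun pm pr pmin.
have s_p (q : {poly {fraction {poly C}}}) z :
    s (map_poly iota q).[z] = (map_poly iota q).[s z].
  rewrite -horner_map /=; congr _.[_]; apply/polyP=> i.
  by rewrite !coef_map /= s_id.
have E1 := derivation_horner dD (map_poly iota p) y.
have E2 := derivation_horner dD (map_poly iota p) (s y).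
move: E1 E2; rewrite -s_p (rootP pr) derivation0 // rmorph0 derivation0 //.
move=> /(congr1 s); rewrite rmorph0 rmorphD rmorphM /= deriv_map s_p -horner_map /=.
have -> : map_poly s (map_poly D (map_poly iota p)) = map_poly D (map_poly iota p).
  apply/polyP=> i; rewrite coef_map !coef_map_id0 ?rmorph0 ?derivation0 //.
  by have [t /= ->] := ddz_iota p`_i; rewrite s_id.
move=> -> /eqP; rewrite -subr_eq0 opprD addrACA subrr add0r -mulrBr mulf_eq0 subr_eq0.
case/orP=> [|/eqP//]; rewrite -s_p fmorph_eq0 => /eqP/rootP.
by rewrite (negbTE psep).
Qed.

End RationalDerivation.

(** * Linear differential operators and the Wronskian *)

Section LinearOperators.
Variables (C K : fieldType) (k : {rmorphism C -> K}) (D : K -> K).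
Hypothesis dD : derivation D.
Hypothesis Dk : forall c, D (k c) = 0.
Hypothesis D_eq0 : forall y, D y = 0 -> exists c, y = k c.

Let D0 := derivation0 dD.
Let DD := derivationD dD.
Let DM := derivationM dD.

Lemma op_evalE N (L : {poly K}) y : (size L <= N)%N ->
  op_eval D L y = \sum_(i < N) L`_i * iter i D y.
Proof.
move=> leN; rewrite /op_eval (big_ord_widen N (fun i => L`_i * iter i D y)) //.
rewrite big_mkcond; apply: eq_bigr => i _; case: ltnP => // le.
by rewrite nth_default // mul0r.
Qed.

Lemma iter_derivationD i x y : iter i D (x + y) = iter i D x + iter i D y.
Proof. by elim: i => //= i ->. Qed.

Lemma iter_derivationZ i c x : iter i D (k c * x) = k c * iter i D x.
Proof. by elim: i => //= i ->; rewrite DM Dk mul0r add0r. Qed.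

Lemma iter_derivation0 i : iter i D 0 = 0.
Proof. by elim: i => //= i ->. Qed.

Lemma op_evalD L x y : op_eval D L (x + y) = op_eval D L x + op_eval D L y.
Proof.
by rewrite -big_split; apply: eq_bigr => i _; rewrite iter_derivationD mulrDr.
Qed.

Lemma op_eval_cst L c y : op_eval D L (k c * y) = k c * op_eval D L y.
Proof.
by rewrite mulr_sumr; apply: eq_bigr => i _; rewrite iter_derivationZ mulrCA.
Qed.

Lemma op_eval0 L : op_eval D L 0 = 0.
Proof. by rewrite /op_eval big1 // => i _; rewrite iter_derivation0 mulr0. Qed.

Lemma op_eval_comb n (b : 'I_n -> K) L (v : 'rV[C]_n) :
  (forall i, solution D L (b i)) -> solution D L (\sum_i k (v 0 i) * b i).
Proof.
move=> Lb; rewrite /solution; apply: (big_ind (fun y => op_eval D L y = 0)).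
- exact: op_eval0.
- by move=> x y Lx Ly; rewrite op_evalD Lx Ly addr0.
- by move=> i _; rewrite op_eval_cst Lb mulr0.
Qed.

Lemma op_eval_addl P Q y : op_eval D (P + Q) y = op_eval D P y + op_eval D Q y.
Proof.
have lP := leq_maxl (size P) (size Q); have lQ := leq_maxr (size P) (size Q).
rewrite (op_evalE _ lP) (op_evalE _ lQ) (op_evalE _ (size_polyD P Q)) -big_split.
by apply: eq_bigr => i _; rewrite coefD mulrDl.
Qed.

Lemma op_eval_scale a Q y : op_eval D (a *: Q) y = a * op_eval D Q y.
Proof.
rewrite (op_evalE _ (size_scale_leq a Q)) mulr_sumr.
by apply: eq_bigr => i _; rewrite coefZ mulrA.
Qed.

Lemma op_eval_zero_op y : op_eval D 0 y = 0.
Proof. by rewrite /op_eval size_poly0 big_ord0. Qed.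

Lemma op_eval_opp Q y : op_eval D (- Q) y = - op_eval D Q y.
Proof. by rewrite -scaleN1r op_eval_scale mulN1r. Qed.

(** By induction on n: when the last coefficient of a relation over K is
    normalised to 1, its derivative is a relation of the same kind between the
    first n functions, so it is trivial; the coefficients are then constants and
    the relation contradicts independence over C. *)
Lemma wronskian_relation n (b a : nat -> K) :
  (forall v : nat -> C, \sum_(j < n) k (v j) * b j = 0 ->
     forall j, (j < n)%N -> v j = 0) ->
  (forall i, (i < n)%N -> \sum_(j < n) a j * iter i D (b j) = 0) ->
  forall j, (j < n)%N -> a j = 0.
Proof.
elim: n a => // n IH a b_free rel.
have b_free' (v : nat -> C) : \sum_(j < n) k (v j) * b j = 0 ->
    forall j, (j < n)%N -> v j = 0.
  move=> v0 j ltj; have := b_free (fun j => if (j < n)%N then v j else 0).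
  rewrite big_ord_recr /= ltnn rmorph0 mul0r addr0.
  have -> : \sum_(i < n) k (if (i < n)%N then v i else 0) * b i = 0.
    by rewrite -[RHS]v0; apply: eq_bigr => i _; rewrite ltn_ord.
  by move=> /(_ erefl j (ltnW ltj)); rewrite ltj.
have [an0|an] := eqVneq (a n) 0.
  move=> j; rewrite ltnS leq_eqVlt => /orP[/eqP->//|]; apply: IH => // i lti.
  by have := rel i (ltnW lti); rewrite big_ord_recr /= an0 mul0r addr0.
pose a' j := a j / a n.
have rel' i : (i < n.+1)%N -> \sum_(j < n.+1) a' j * iter i D (b j) = 0.
  move=> lti; transitivity ((\sum_(j < n.+1) a j * iter i D (b j)) / a n).
    rewrite mulr_suml; apply: eq_bigr => j _; by rewrite /a' mulrAC.
  by rewrite rel // mul0r.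
have a'n : a' n = 1 by rewrite /a' divff.
have Da' j : (j < n)%N -> D (a' j) = 0.
  apply: (IH (fun j => D (a' j))) => // i lti.
  have := congr1 D (rel' i (ltnW lti)); rewrite D0 derivation_sum //.
  under eq_bigr do rewrite DM.
  rewrite big_split /= -[X in _ + X]/(\sum_(j < n.+1) a' j * iter i.+1 D (b j)).
  by rewrite rel' // addr0 big_ord_recr /= a'n derivation1 // mul0r addr0.
have cst j : exists c, (j < n.+1)%N -> a' j = k c.
  rewrite ltnS leq_eqVlt; have [->|_] := eqVneq j n.
    by exists 1; rewrite rmorph1.
  by have [/Da'/D_eq0[c ->]|_] := ltnP j n; [exists c | exists 0].
have [v vP] := choice cst.
have v0 : \sum_(j < n.+1) k (v j) * b j = 0.
  rewrite -[RHS](rel' 0%N) //; apply: eq_bigr => j _; rewrite vP //.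
have := b_free v v0 n (ltnSn n); have := vP n (ltnSn n); rewrite a'n => kv vn.
by move/eqP: kv; rewrite vn rmorph0 oner_eq0.
Qed.

Definition free_over n (b : 'I_n -> K) : Prop :=
  forall v : 'rV[C]_n, \sum_(i < n) k (v 0 i) * b i = 0 -> v = 0.

Definition wronskian n (b : 'I_n -> K) : 'M[K]_n := \matrix_(i, j) iter i D (b j).

Lemma wronskian_unit n (b : 'I_n -> K) : free_over b -> wronskian b \in unitmx.
Proof.
move=> b_free; rewrite unitmxE unitfE -det_tr; apply/det0P => -[v v0 vW].
pose ext T (x0 : T) (f : 'I_n -> T) j := oapp f x0 (insub j : option 'I_n).
have extE T x0 (f : 'I_n -> T) (j : 'I_n) : ext T x0 f j = f j.
  by rewrite /ext valK.
case/eqP: v0; apply/rowP => j; rewrite mxE -(extE _ 0 (fun j => v 0 j)).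
apply: (@wronskian_relation n (ext _ 0 b)) => //.
- move=> w w0 i lti; have := b_free (\row_i w i).
  rewrite (_ : \sum_(i < n) _ = 0); last first.
    by rewrite -[RHS]w0; apply: eq_bigr => l _; rewrite mxE extE.
  by move/(_ erefl)/rowP/(_ (Ordinal lti)); rewrite !mxE.
- move=> i lti; move/rowP: vW => /(_ (Ordinal lti)); rewrite !mxE => E.
  by rewrite -[RHS]E; apply: eq_bigr => l _; rewrite !mxE !extE.
Qed.

(** The coefficients of P form a row vector in the kernel of the Wronskian. *)
Lemma op_kill_eq0 n (b : 'I_n -> K) (P : {poly K}) : free_over b ->
  (size P <= n)%N -> (forall i, solution D P (b i)) -> P = 0.
Proof.
move=> b_free sP Pb; pose r : 'rV[K]_n := \row_i P`_i.
have rW : r *m wronskian b = 0.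
  apply/rowP => j; rewrite !mxE -[RHS](Pb j) (op_evalE _ sP).
  by apply: eq_bigr => i _; rewrite !mxE.
have r0 : r = 0 by rewrite -[r](mulmxK (wronskian_unit b_free)) rW mul0mx.
apply/polyP => i; rewrite coef0; have [lti|lei] := ltnP i n.
  by move/rowP: r0 => /(_ (Ordinal lti)); rewrite !mxE.
by rewrite nth_default // (leq_trans sP).
Qed.

Lemma monic_op_unique n (b : 'I_n -> K) L1 L2 : free_over b ->
  monic_op n L1 -> monic_op n L2 ->
  (forall i, solution D L1 (b i)) -> (forall i, solution D L2 (b i)) -> L1 = L2.
Proof.
move=> b_free [m1 s1] [m2 s2] k1 k2; apply/eqP; rewrite -subr_eq0; apply/eqP.
apply: (op_kill_eq0 b_free); last first.
  by move=> i; rewrite /solution op_eval_addl op_eval_opp k1 k2 subrr.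
apply/leq_sizeP => j; rewrite leq_eqVlt coefB => /orP[/eqP<-|ltj].
  have [] := (monicP m1, monicP m2); rewrite !lead_coefE s1 s2 /= => -> ->.
  by rewrite subrr.
by rewrite !nth_default ?subrr ?s1 ?s2.
Qed.

Lemma monic_op_exists n (b : 'I_n -> K) : free_over b ->
  exists L, monic_op n L /\ forall i, solution D L (b i).
Proof.
move=> b_free.
pose r := - (\row_j iter n D (b j)) *m invmx (wronskian b).
pose P := \poly_(i < n) oapp (fun i => r 0 i) 0 (insub i : option 'I_n).
have sP : (size P < size ('X^n : {poly K}))%N by rewrite size_polyXn ltnS size_poly.
exists ('X^n + P); split.
  rewrite /monic_op monicE lead_coefDl // lead_coefXn eqxx.
  by rewrite size_polyDl // size_polyXn.
move=> j; rewrite /solution op_eval_addl.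
rewrite (@op_evalE n.+1) ?size_polyXn // big_ord_recr /= coefXn eqxx mul1r.
rewrite big1 ?add0r => [|i _]; last by rewrite coefXn ltn_eqF ?mul0r.
rewrite (@op_evalE n) ?size_poly //.
have /rowP/(_ j) : r *m wronskian b = - (\row_j iter n D (b j)).
  by rewrite mulmxKV // wronskian_unit.
rewrite !mxE => E; apply/eqP; rewrite addr_eq0; apply/eqP.
rewrite -[LHS]opprK -E; congr (- _); apply: eq_bigr => i _.
by rewrite coef_poly ltn_ord valK /= [wronskian b _ _]mxE.
Qed.

(** A further solution y would give n + 1 independent functions killed by an
    operator of order n. *)
Lemma monic_op_solution n (b : 'I_n -> K) L : free_over b -> monic_op n L ->
  (forall i, solution D L (b i)) ->
  forall y, solution D L y <-> exists v : 'rV[C]_n, y = \sum_i k (v 0 i) * b i.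
Proof.
move=> b_free [mL sL] Lb y; split=> [Ly|[v ->]]; last exact: op_eval_comb.
pose b' (i : 'I_n.+1) := oapp b y (unlift ord_max i).
have b'_max : b' ord_max = y by rewrite /b' unlift_none.
have b'_lift i : b' (widen_ord (leqnSn n) i) = b i.
  rewrite /b' (_ : widen_ord _ i = lift ord_max i) ?liftK //.
  by apply: val_inj; exact: (esym (lift_max i)).
have nfree : ~ free_over b'.
  move=> /op_kill_eq0/(_ (eq_leq sL)) L0; move/eqP: (monic_neq0 mL); apply.
  by apply: L0 => i; rewrite /b'; case: unliftP => [j|] _ /=.
have [v [v0 vb]] : exists v : 'rV[C]_n.+1,
    v <> 0 /\ \sum_i k (v 0 i) * b' i = 0.
  apply: contrapT => nv; apply: nfree => v vb; apply: contrapT => v0.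
  by apply: nv; exists v.
move: vb; rewrite big_ord_recr /= b'_max; under eq_bigr do rewrite b'_lift.
have [vn vb|vn] := eqVneq (v 0 ord_max) 0.
  case: v0; move: vb; rewrite vn rmorph0 mul0r addr0 => vb.
  have := b_free (\row_i v 0 (widen_ord (leqnSn n) i)).
  rewrite (_ : \sum_(i < n) _ = 0); last first.
    by rewrite -[RHS]vb; apply: eq_bigr => i _; rewrite mxE.
  move=> /(_ erefl)/rowP vi; apply/rowP => i; rewrite mxE.
  have [j ->|->//] := unliftP ord_max i; have := vi j; rewrite !mxE => <-.
  by congr (v 0 _); apply: val_inj; exact: (lift_max j).
move/eqP; rewrite addrC addr_eq0 => /eqP E.
exists (\row_i (- (v 0 ord_max)^-1 * v 0 (widen_ord (leqnSn n) i))).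
have kvn : k (v 0 ord_max) != 0 by rewrite fmorph_eq0.
apply: (mulfI kvn); rewrite E mulr_sumr -sumrN; apply: eq_bigr => i _.
by rewrite mxE rmorphM rmorphN fmorphV; field.
Qed.

Lemma derivation_det n (A : 'M[K]_n) :
  D (\det A) = \sum_i \det (\matrix_(l, j) if l == i then D (A l j) else A l j).
Proof.
rewrite /determinant derivation_sum // [RHS]exchange_big; apply: eq_bigr => s _.
rewrite DM (_ : D ((-1) ^+ s) = 0) ?mul0r ?add0r; last first.
  by rewrite -[-1](rmorphN1 k) -rmorphXn Dk.
rewrite derivation_prod // mulr_sumr; apply: eq_bigr => i _; congr (_ * _).
rewrite [RHS](bigD1 i) //= mxE eqxx; congr (_ * _).
by apply: eq_bigr => j /negbTE ji; rewrite mxE ji.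
Qed.

(** Differentiating a row of the Wronskian other than the last repeats the next
    row; the derivative of the last row is the combination of all rows that L
    prescribes. *)
Lemma abel n (b : 'I_n.+1 -> K) L : monic_op n.+1 L ->
  (forall i, solution D L (b i)) ->
  D (\det (wronskian b)) = - L`_n * \det (wronskian b).
Proof.
move=> [mL sL] Lb; rewrite derivation_det big_ord_recr /= big1 ?add0r; last first.
  move=> i _; set A := \matrix_(_, _) _.
  apply: (@determinant_alternate _ _ A (widen_ord (leqnSn n) i) (lift ord0 i)).
    by apply/eqP => /(congr1 val) /= /eqP; rewrite /bump /= add1n ltn_eqF.
  move=> j; rewrite !mxE eqxx ifF //=; apply/negbTE/eqP => /(congr1 val) /= /eqP.
  by rewrite /bump /= add1n gtn_eqF.
have Ln : L`_n.+1 = 1 by have := monicP mL; rewrite lead_coefE sL.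
(* The Wronskian with its last row replaced by the i-th derivatives. *)
pose B i := \matrix_(l, j) if l == ord_max then iter i D (b j) else wronskian b l j.
have detB (i : 'I_n.+1) : i != ord_max -> \det (B i) = 0.
  move=> i_max; apply: (determinant_alternate i_max) => j.
  by rewrite !mxE eqxx (negbTE i_max).
transitivity (\sum_(i < n.+1) - L`_i * \det (B i)); last first.
  rewrite big_ord_recr /= big1 ?add0r; last first.
    move=> i _; rewrite (detB (widen_ord (leqnSn n) i)) ?mulr0 //.
    by apply/eqP => /(congr1 val) /= /eqP; rewrite ltn_eqF.
  congr (_ * \det _); apply/matrixP => l j; rewrite !mxE.
  by case: eqP => [->|].
have expand (M : 'M[K]_n.+1) (f : 'I_n.+1 -> K) :
    M = \matrix_(l, j) (if l == ord_max then f j else wronskian b l j) ->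
    \det M = \sum_j f j * cofactor (wronskian b) ord_max j.
  move=> ->; rewrite (expand_det_row _ ord_max); apply: eq_bigr => j _.
  rewrite mxE eqxx; congr (_ * (_ * \det _)); apply/matrixP => l m.
  by rewrite !mxE eq_sym (negbTE (neq_lift _ _)).
rewrite (expand _ (fun j => iter n.+1 D (b j))); last first.
  by apply/matrixP => l j; rewrite !mxE; case: eqP => // ->.
under [RHS]eq_bigr do rewrite (expand _ _ erefl) mulr_sumr.
rewrite exchange_big; apply: eq_bigr => j _ /=.
pose cof := cofactor (wronskian b) ord_max j; rewrite -/cof.
rewrite (eq_bigr (fun i : 'I_n.+1 => - (L`_i * iter i D (b j)) * cof)).
  rewrite -mulr_suml sumrN; congr (_ * _); apply/eqP.
  rewrite -addr_eq0 addrC; apply/eqP; have := Lb j.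
  by rewrite /solution (@op_evalE n.+2) ?sL // big_ord_recr /= Ln mul1r.
by move=> i _; rewrite -mulNr mulrA.
Qed.

Lemma op_eval_mul_shift a Q y :
  op_eval D (op_mul_shift D a Q) y = D (op_eval D Q y) + a * op_eval D Q y.
Proof.
rewrite /op_mul_shift !op_eval_addl op_eval_scale; congr (_ + _).
rewrite (@op_evalE (size Q).+1); last first.
  by rewrite mulrC (leq_trans (size_polyMleq _ _)) // size_polyX addn2.
rewrite big_ord_recl coefXM mul0r add0r.
rewrite (@op_evalE (size Q) (map_poly D Q)); last exact: size_poly.
rewrite /op_eval (derivation_sum dD) -big_split; apply: eq_bigr => i _.
by rewrite DM coefXM coef_map_id0 //= addrC.
Qed.

(** Conjugation by h: the substitution of d/dz + h'/h for d/dz in L gives the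
    operator h^-1 L h. *)
Lemma op_eval_shift (h : K) L y : h != 0 ->
  op_eval D (op_shift D (D h / h) L) y = h^-1 * op_eval D L (h * y).
Proof.
move=> h0; rewrite /op_shift.
rewrite (big_morph (fun Q => op_eval D Q y)
  (fun P Q => op_eval_addl P Q y) (op_eval_zero_op y)).
rewrite /op_eval mulr_sumr; apply: eq_bigr => i _.
rewrite -/(op_eval D _ y) op_eval_scale mulrCA; congr (_ * _).
elim: {i}(nat_of_ord i) => /= [|i IH].
  by rewrite /op_eval size_poly1 big_ord1 coefC /= mul1r mulKf.
rewrite op_eval_mul_shift IH DM (derivationV dD) //; field.
by rewrite h0.
Qed.

Lemma solution_shift (h : K) L y : h != 0 ->
  solution D (op_shift D (D h / h) L) y <-> solution D L (h * y).
Proof.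
move=> h0; rewrite /solution op_eval_shift //; split=> [/eqP|->]; last by rewrite mulr0.
by rewrite mulf_eq0 invr_eq0 (negbTE h0) => /eqP.
Qed.

(** (d/dz + a)^i = (d/dz)^i + i a (d/dz)^(i-1) + ... *)
Lemma iter_mul_shift_coefs a i :
  let Q := iter i (op_mul_shift D a) 1 in
  [/\ (size Q <= i.+1)%N, Q`_i = 1 & (0 < i)%N -> Q`_i.-1 = i%:R * a].
Proof.
elim: i => [|i [IHs IHi IHp]] /=; first by rewrite size_poly1 coefC.
have coefS Q j : (op_mul_shift D a Q)`_j =
    (if j == 0 then 0 else Q`_j.-1) + D Q`_j + a * Q`_j.
  by rewrite /op_mul_shift !coefD coefXM coefZ coef_map_id0.
split.
- apply/leq_sizeP => j ltj; rewrite coefS gtn_eqF ?(leq_ltn_trans _ ltj) //.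
  have lej : (size (iter i (op_mul_shift D a) 1%R) <= j.-1)%N.
    by rewrite (leq_trans IHs) // -ltnS (ltn_predK ltj).
  rewrite !(nth_default _ lej) !(nth_default _ (leq_trans lej (leq_pred _))).
  by rewrite D0 mulr0 !addr0.
- by rewrite coefS /= IHi nth_default // D0 mulr0 !addr0.
move=> _; rewrite coefS IHi derivation1 // addr0 mulr1 mulrS mulrDl mul1r addrC.
congr (_ + _); case: i IHp {IHs IHi} => [_|i /(_ isT)] //=; by rewrite mul0r.
Qed.

Lemma op_shift_coefs a n L : monic_op n.+1 L ->
  monic_op n.+1 (op_shift D a L) /\ (op_shift D a L)`_n = n.+1%:R * a + L`_n.
Proof.
move=> [mL sL]; have Ln : L`_n.+1 = 1 by have := monicP mL; rewrite lead_coefE sL.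
pose Q i := iter i (op_mul_shift D a) 1.
have coefS j : (op_shift D a L)`_j = \sum_(i < n.+2) L`_i * (Q i)`_j.
  rewrite /op_shift coef_sum sL; apply: eq_bigr => i _; by rewrite coefZ.
have Q0 i j : (i < j)%N -> (Q i)`_j = 0.
  move=> ltij; have [s _ _] := iter_mul_shift_coefs a i.
  by rewrite nth_default // (leq_trans s).
have top : (op_shift D a L)`_n.+1 = 1.
  rewrite coefS big_ord_recr /= big1 ?add0r => [|i _]; last by rewrite Q0 ?mulr0.
  by have [_ E _] := iter_mul_shift_coefs a n.+1; rewrite Ln mul1r [LHS]E.
have s_le : (size (op_shift D a L) <= n.+2)%N.
  apply/leq_sizeP => j ltj; rewrite coefS big1 // => i _.
  by rewrite Q0 ?mulr0 // (leq_trans (ltn_ord i)).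
have s_eq : size (op_shift D a L) = n.+2.
  apply/eqP; rewrite eqn_leq s_le ltnNge; apply/negP => le.
  by move/eqP: top; rewrite nth_default // eq_sym oner_eq0.
split; first by split=> //; rewrite monicE lead_coefE s_eq top.
rewrite coefS big_ord_recr big_ord_recr /= big1 ?add0r => [|i _]; last first.
  by rewrite Q0 ?mulr0.
have [_ _ E1] := iter_mul_shift_coefs a n.+1; have [_ E2 _] := iter_mul_shift_coefs a n.
by rewrite [(Q n.+1)`_n](E1 isT) [(Q n)`_n]E2 Ln mul1r mulr1 addrC.
Qed.

(** Two operators whose solution spaces differ by a factor m are conjugate by m,
    so their coefficients of second highest order differ by a multiple of m'/m;
    hence m is a constant and the solution spaces coincide. *)
Lemma standard_form_unique n (b : 'I_n.+1 -> K) (L1 L2 : {poly K}) (m : K) :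
  [pchar K] =i pred0 ->
  free_over b -> monic_op n.+1 L1 -> monic_op n.+1 L2 ->
  L1`_n = 0 -> L2`_n = 0 -> m != 0 ->
  (forall i, solution D L1 (b i)) -> (forall i, solution D L2 (m * b i)) ->
  L1 = L2.
Proof.
move=> charK b_free mo1 mo2 L1n L2n m0 k1 k2.
have [mos cs] := op_shift_coefs (D m / m) mo2.
have L1E : L1 = op_shift D (D m / m) L2.
  by apply: (monic_op_unique b_free mo1 mos k1) => i; apply/solution_shift.
have Dm : D m = 0.
  move/eqP: cs; rewrite -L1E L1n L2n addr0 eq_sym mulf_eq0.
  move/pcharf0P: charK => -> /=; rewrite mulf_eq0 invr_eq0 (negbTE m0) orbF.
  by move/eqP.
have [c mc] := D_eq0 Dm; apply: (monic_op_unique b_free mo1 mo2 k1) => i.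
have := k2 i; rewrite /solution mc op_eval_cst => /eqP.
by rewrite mulf_eq0 -mc (negbTE m0) => /eqP.
Qed.

End LinearOperators.

(** * Linear forms and the function field *)

Section LinearForms.
Variables (C : fieldType) (n : nat).
Implicit Types (u v : 'rV[C]_n) (A B : 'M[C]_n) (p q : {mpoly C[n]}).

Lemma lin_is_linear : linear (@lin C n).
Proof.
move=> a u v; rewrite /lin scaler_sumr -big_split; apply: eq_bigr => i _ /=.
by rewrite !mxE scalerDl scalerA.
Qed.

HB.instance Definition _ :=
  GRing.isLinear.Build C 'rV[C]_n {mpoly C[n]} *:%R (@lin C n) lin_is_linear.

Lemma lin_delta i : lin (delta_mx 0 i) = 'X_i :> {mpoly C[n]}.
Proof.
rewrite /lin (bigD1 i) //= mxE !eqxx scale1r big1 ?addr0 // => j ji.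
by rewrite mxE (negbTE ji) scale0r.
Qed.

Lemma lin_homog v : lin v \is 1.-homog.
Proof.
apply: rpred_sum => i _; apply: rpredZ.
by rewrite dhomogX; apply/eqP; exact: mdeg1.
Qed.

Lemma lin_eq0 v : lin v = 0 -> v = 0.
Proof.
move=> v0; apply/rowP => i; rewrite mxE.
have := congr1 (fun p : {mpoly C[n]} => p@_(U_(i)%MM)) v0.
rewrite /lin raddf_sum mcoeff0 (bigD1 i) //= mcoeffZ mcoeffX eqxx mulr1.
rewrite big1 ?addr0 // => j ji.
by rewrite mcoeffZ mcoeffX eq_mnm1 (negbTE ji) mulr0.
Qed.

Lemma sym_act_lin A v : sym_act A (lin v) = lin (v *m A).
Proof.
rewrite /sym_act /lin raddf_sum /=; transitivity (\sum_i v 0 i *: lin (row i A)).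
  by apply: eq_bigr => i _; rewrite comp_mpolyZ comp_mpolyXU -tnth_nth tnth_mktuple.
rewrite mulmx_sum_row -[RHS]/(lin _) raddf_sum; apply: eq_bigr => i _.
by rewrite /= linearZ.
Qed.

Lemma sym_actX A i : sym_act A 'X_i = lin (row i A).
Proof. by rewrite -lin_delta sym_act_lin rowE. Qed.

Lemma sym_act_homog A d p : p \is d.-homog -> sym_act A p \is d.-homog.
Proof.
move=> /dhomogP hp; rewrite /sym_act comp_mpolyE big_seq.
apply: rpred_sum => m /hp; rewrite -[X in X = d]/(mdeg m) mdegE => <-.
apply: rpredZ.
apply: (big_ind2 (fun d q => q \is d.-homog)) => [|d1 q1 d2 q2|i _].
- exact: dhomog1.
- exact: dhomogM.
- by rewrite tnth_mktuple -[X in X.-homog]mul1n dhomogMn ?lin_homog.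
Qed.

Lemma sym_actM A B p : sym_act A (sym_act B p) = sym_act (B *m A) p.
Proof.
rewrite /sym_act (comp_mpolyE p) (comp_mpolyE p) raddf_sum; apply: eq_bigr => m _ /=.
rewrite comp_mpolyZ rmorph_prod /=; congr (_ *: _); apply: eq_bigr => i _.
by rewrite rmorphXn /= !tnth_mktuple -/(sym_act A _) sym_act_lin row_mul.
Qed.

Lemma sym_act1 p : sym_act 1%:M p = p.
Proof.
rewrite -[RHS]comp_mpoly_id /sym_act; congr comp_mpoly; apply: eq_mktuple => i.
by rewrite row1 lin_delta.
Qed.

End LinearForms.

Section FunctionFieldArithmetic.
Variables (C : fieldType) (n : nat) (I : prime_idealr {mpoly C[n]}).
Implicit Types (p q : {mpoly C[n]}).

(** Outside these conditions [ffrac] may take its default value. *)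
Definition is_fraction d p q := [/\ p \is d.-homog, q \is d.-homog & q \notin I].

Let t (p : {mpoly C[n]}) : {fraction prime_quot I} := tofrac (to_quot I p).

Let tM p q : t (p * q) = t p * t q.
Proof. by rewrite /t rmorphM /= tofracM. Qed.

Let tB p q : t (p - q) = t p - t q.
Proof. by rewrite /t rmorphB /= tofracB. Qed.

Let t1 : t 1 = 1.
Proof. by rewrite /t rmorph1 /= tofrac1. Qed.

Let t_eq0 p : (t p == 0) = (p \in I).
Proof. by rewrite /t tofrac_eq0 to_quot_eq0. Qed.

Let V : {rmorphism function_field I -> {fraction prime_quot I}} := \val.

Let V_inj : injective V.
Proof. exact: val_inj. Qed.

Let val_ffrac d p q : is_fraction d p q -> V (ffrac I p q) = coord_frac I p q.
Proof.
move=> [hp hq nq]; rewrite /ffrac /= insubdK //.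
by apply/asboolP; exists d, p, q.
Qed.

Lemma function_field_frac (u : function_field I) :
  exists d p q, is_fraction d p q /\ u = ffrac I p q.
Proof.
case: u => u hu; have [d [p [q [hp hq nq def_u]]]] := asboolP _ hu.
exists d, p, q; split=> //; by apply: V_inj; rewrite (@val_ffrac d).
Qed.

Lemma ffrac_eq0 d p q : is_fraction d p q -> (ffrac I p q == 0) = (p \in I).
Proof.
move=> fr; have [_ _ nq] := fr; rewrite -(inj_eq V_inj) (val_ffrac fr) rmorph0.
by rewrite mulf_eq0 invr_eq0 -/(t p) -/(t q) !t_eq0 (negbTE nq) orbF.
Qed.

Lemma is_fractionM d p q d' p' q' : is_fraction d p q -> is_fraction d' p' q' ->
  is_fraction (d + d')%N (p * p') (q * q').
Proof.
move=> [hp hq nq] [hp' hq' nq']; split; rewrite ?dhomogM //.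
by rewrite prime_idealrM negb_or nq.
Qed.

Lemma is_fractionB d p q d' p' q' : is_fraction d p q -> is_fraction d' p' q' ->
  is_fraction (d + d')%N (p * q' - p' * q) (q * q').
Proof.
move=> [hp hq nq] [hp' hq' nq']; split; rewrite ?dhomogM //.
  by apply: rpredB; [rewrite dhomogM | rewrite addnC dhomogM].
by rewrite prime_idealrM negb_or nq.
Qed.

Lemma ffracM d p q d' p' q' : is_fraction d p q -> is_fraction d' p' q' ->
  ffrac I p q * ffrac I p' q' = ffrac I (p * p') (q * q').
Proof.
move=> fr fr'; apply: V_inj; rewrite rmorphM.
rewrite (val_ffrac fr) (val_ffrac fr') (val_ffrac (is_fractionM fr fr')).
by rewrite /coord_frac -!/(t _) !tM mulf_div.
Qed.

Lemma ffracB d p q d' p' q' : is_fraction d p q -> is_fraction d' p' q' ->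
  ffrac I p q - ffrac I p' q' = ffrac I (p * q' - p' * q) (q * q').
Proof.
move=> fr fr'; have [[_ _ nq] [_ _ nq']] := (fr, fr').
apply: V_inj; rewrite rmorphB.
rewrite (val_ffrac fr) (val_ffrac fr') (val_ffrac (is_fractionB fr fr')).
rewrite /coord_frac -!/(t _) tB !tM -mulNr addf_div ?t_eq0 // mulNr.
by [].
Qed.

Lemma ffrac_cancel d p q r : is_fraction d p q -> is_fraction d q r ->
  ffrac I p q * ffrac I q r = ffrac I p r.
Proof.
move=> fr fr'; have [[hp _ nq] [_ hr nr]] := (fr, fr').
have fr'' : is_fraction d p r by [].
apply: V_inj; rewrite rmorphM (val_ffrac fr) (val_ffrac fr') (val_ffrac fr'').
by rewrite /coord_frac -!/(t _) mulrA divfK ?t_eq0.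
Qed.

Lemma ffrac_neq0 d p q : is_fraction d p q -> p \notin I -> ffrac I p q != 0.
Proof. by move=> fr; rewrite (ffrac_eq0 fr). Qed.

Lemma is_fraction_lin u v : lin v \notin I -> is_fraction 1 (lin u) (lin v).
Proof. by move=> nv; split; rewrite ?lin_homog. Qed.

Lemma is_fraction_const c : is_fraction 0 c%:MP 1.
Proof.
split; rewrite ?dhomog1 ?idealr1 //.
by rewrite -[_%:MP]mulr1 mul_mpolyC rpredZ // dhomog1.
Qed.

Lemma ff_const_zmod : zmod_morphism (ff_const I).
Proof.
have fr := is_fraction_const.
move=> x y; rewrite /ff_const (ffracB (fr x) (fr y)) !mulr1.
by rewrite mpolyCB.
Qed.

Lemma ff_const_monoid : monoid_morphism (ff_const I).
Proof.
have fr := is_fraction_const.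
split=> [|x y]; last by rewrite /ff_const (ffracM (fr x) (fr y)) mulr1 mpolyCM.
apply: V_inj; rewrite rmorph1 (val_ffrac (fr 1)) /coord_frac divff //.
by rewrite -/(t _) t1 oner_eq0.
Qed.

HB.instance Definition _ :=
  GRing.isZmodMorphism.Build C (function_field I) (ff_const I) ff_const_zmod.
HB.instance Definition _ :=
  GRing.isMonoidMorphism.Build C (function_field I) (ff_const I) ff_const_monoid.

(** Dehomogenisation: a homogeneous form of degree d, evaluated at the
    coordinate functions X_i/l, becomes p/l^d. *)
Lemma mmap_homog (l : 'rV[C]_n) d p : lin l \notin I -> p \is d.-homog ->
  mmap (ff_const I) (fun i => ffrac I 'X_i (lin l)) p = ffrac I p (lin l ^+ d).
Proof.
move=> nl hp; have tl : t (lin l) != 0 by rewrite t_eq0.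
have tX k q : t (q ^+ k) = t q ^+ k.
  by elim: k => [|k IH]; rewrite ?expr0 // !exprS tM IH.
have nld : lin l ^+ d \notin I by rewrite -t_eq0 tX expf_neq0.
have frp : is_fraction d p (lin l ^+ d).
  by split=> //; rewrite -[X in X.-homog]mul1n dhomogMn ?lin_homog.
apply: V_inj; rewrite (val_ffrac frp) /mmap rmorph_sum.
have -> : coord_frac I p (lin l ^+ d) =
    \sum_(m <- msupp p) t (p@_m)%:MP * t 'X_[m] / t (lin l) ^+ d.
  rewrite /coord_frac -!/(t _) tX -mulr_suml; congr (_ / _).
  rewrite {1}[p]mpolyE /t raddf_sum raddf_sum /=; apply: eq_bigr => m _.
  by rewrite -mul_mpolyC -!/(t _) tM.
rewrite !big_seq; apply: eq_bigr => m mp; rewrite rmorphM -mulrA.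
have frC := is_fraction_const p@_m.
rewrite {1}/ff_const (val_ffrac frC) {1}/coord_frac -!/(t _) t1 divr1; congr (_ * _).
have <- : mdeg m = d := dhomogP _ _ _ hp m mp.
rewrite mdegE -prodrXr mpolyXE_id /mmap1 rmorph_prod.
have -> : t (\prod_(i < n) 'X_i ^+ m i) = \prod_(i < n) t 'X_i ^+ m i.
  by rewrite /t rmorph_prod /= rmorph_prod; apply: eq_bigr => i _; rewrite -tX.
rewrite -prodf_div; apply: eq_bigr => i _; rewrite rmorphXn.
have := val_ffrac (is_fraction_lin (delta_mx 0 i) nl); rewrite lin_delta => ->.
by rewrite /coord_frac expr_div_n.
Qed.

Lemma ffrac_lin (l v : 'rV[C]_n) : lin l \notin I ->
  ffrac I (lin v) (lin l) = \sum_i ff_const I (v 0 i) * ffrac I 'X_i (lin l).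
Proof.
move=> nl; rewrite -[in LHS](expr1 (lin l)) -(mmap_homog nl (lin_homog v)).
rewrite raddf_sum /=; apply: eq_bigr => i _.
by rewrite mmapZ mmapX mmap1U.
Qed.

End FunctionFieldArithmetic.

(** * The Galois group and the action of G on the function field *)

Section OrbitPolynomial.
Variables (E K : fieldType) (e : {rmorphism E -> K}).
Variables (gT : finGroupType) (G : {group gT}) (c : gT -> E).

Definition orbit_poly : {poly E} := \prod_(x in G) ('X - (c x)%:P).

Lemma orbit_poly_horner z :
  (map_poly e orbit_poly).[z] = \prod_(x in G) (z - e (c x)).
Proof.
rewrite map_prod_XsubC horner_prod; apply: eq_bigr => x _.
by rewrite !hornerE.
Qed.

Lemma orbit_poly_fixed (t : {rmorphism K -> K}) y : y \in G ->
  (forall x, x \in G -> t (e (c x)) = e (c (x * y)%g)) ->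
  map_poly t (map_poly e orbit_poly) = map_poly e orbit_poly.
Proof.
move=> Gy tc; rewrite !map_prod_XsubC [RHS](reindex_inj (mulIg y)).
apply: eq_big => x /=; first by rewrite groupMr.
by move=> Gx; rewrite tc.
Qed.

End OrbitPolynomial.

Section IrreducibleAction.
Variables (C : fieldType) (n : nat) (I : prime_idealr {mpoly C[n]}).
Variables (gT : finGroupType) (G : {group gT}) (rG : mx_representation C G n).
Hypothesis G_irr : mx_irreducible rG.
Hypothesis G_stable : stable_variety I rG.
Hypothesis I_proper : exists i, 'X_i \notin I.

Lemma sym_act_in x p : x \in G -> (sym_act (rG x) p \in I) = (p \in I).
Proof.
move=> Gx; apply/idP/idP => [|/G_stable]; last exact.
move/(G_stable (groupVr Gx)); rewrite sym_actM -repr_mxM ?groupV // mulgV.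
by rewrite repr_mx1 sym_act1.
Qed.

Lemma is_fraction_act x d p q : x \in G -> is_fraction I d p q ->
  is_fraction I d (sym_act (rG x) p) (sym_act (rG x) q).
Proof. by move=> Gx [hp hq nq]; split; rewrite ?sym_act_homog ?sym_act_in. Qed.

(** The linear forms in I are a G-stable subspace of V, which is not all of V
    since some coordinate is not in I; as V is irreducible, it is zero. *)
Lemma lin_notin (v : 'rV[C]_n) : v != 0 -> lin v \notin I.
Proof.
move=> v0; apply/negP => vI; have [i /negP[]] := I_proper.
have := mxsimple_cyclic G_irr v0 (submx1 v).
move=> /eqmxP/andP[/(submx_trans (submx1 (delta_mx 0 i : 'rV_n)))].
move/cyclic_mxP => [A /envelop_mxP[a ->] E] _.
rewrite -lin_delta E mulmx_sumr raddf_sum; apply: rpred_sum => x Gx.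
rewrite -scalemxAr /= linearZ /= -sym_act_lin -mul_mpolyC.
by apply: idealMr; rewrite sym_act_in.
Qed.

End IrreducibleAction.

Section GaloisAction.
Variables (C K : closedFieldType) (iota : {rmorphism {fraction {poly C}} -> K}).
Hypothesis charC : [pchar C] =i pred0.
Hypothesis K_alg : forall x, algebraicOver iota x.
Variables (n : nat) (I : prime_idealr {mpoly C[n]}).
Variables (gT : finGroupType) (G : {group gT}) (rG : mx_representation C G n).
Hypothesis G_stable : stable_variety I rG.
Variable theta : {rmorphism {fraction {poly C}} -> function_field I}.
Hypothesis theta_quot : quotient_identification rG theta.
Variable e : {rmorphism function_field I -> K}.
Hypothesis e_theta : forall r, e (theta r) = iota r.

Lemma e_const c : e (ff_const I c) = cst iota c.
Proof. by case: theta_quot => <- _; rewrite e_theta. Qed.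

(** p/q |-> (x p)/(x q) is well defined because I is G-stable, and it is the
    identity on the invariant functions, that is, on C(z). *)
Lemma aut_lift x : x \in G -> exists s : {rmorphism K -> K}, galois_aut iota s /\
  forall d p q, is_fraction I d p q ->
    s (e (ffrac I p q)) = e (ffrac I (sym_act (rG x) p) (sym_act (rG x) q)).
Proof.
move=> Gx; pose a := sym_act (rG x).
have aM p q : a (p * q) = a p * a q by apply: rmorphM.
have aB p q : a (p - q) = a p - a q by apply: rmorphB.
pose S u := exists d p q, is_fraction I d p q /\
  u = (e (ffrac I p q), e (ffrac I (a p) (a q))).
have fr_a d p q : is_fraction I d p q -> is_fraction I d (a p) (a q).
  exact: is_fraction_act.
have paS : partial_aut iota S.
  split.
  - move=> r; have [_ inv] := theta_quot.
    have [d [p [q [fr E]]]] := function_field_frac (theta r).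
    have [hp hq nq] := fr; exists d, p, q; split=> //.
    rewrite (_ : ffrac I (a p) (a q) = theta r) -?E ?e_theta //.
    have /inv invr : exists r', theta r' = theta r by exists r.
    exact: (invr x Gx d p q hp hq nq E).
  - move=> _ _ [d [p [q [fr ->]]]] [d' [p' [q' [fr' ->]]]].
    exists (d + d')%N, (p * q' - p' * q), (q * q'); split; first exact: is_fractionB.
    rewrite aB !aM -(ffracB fr fr') -(ffracB (fr_a _ _ _ fr) (fr_a _ _ _ fr')).
    by rewrite !rmorphB.
  - move=> _ _ [d [p [q [fr ->]]]] [d' [p' [q' [fr' ->]]]].
    exists (d + d')%N, (p * p'), (q * q'); split; first exact: is_fractionM.
    rewrite !aM -(ffracM fr fr') -(ffracM (fr_a _ _ _ fr) (fr_a _ _ _ fr')).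
    by rewrite !rmorphM.
  - move=> _ [d [p [q [fr ->]]]] /= /eqP.
    rewrite fmorph_eq0 (ffrac_eq0 fr) => pI; congr (_, _); apply/eqP.
      by rewrite fmorph_eq0 (ffrac_eq0 fr).
    by rewrite fmorph_eq0 (ffrac_eq0 (fr_a _ _ _ fr)) sym_act_in.
have [s [s_aut sS]] := extend_to_aut K_alg paS.
exists s; split=> // d p q fr; apply: (sS (_, _)); by exists d, p, q.
Qed.

Variable l : 'rV[C]_n.
Hypothesis l_notin : lin l \notin I.

Local Notation X := (fun i => ffrac I 'X_i (lin l)).
Local Notation act x p := (sym_act (rG x) p).

Lemma e_frac_lin v : e (ffrac I (lin v) (lin l)) = \sum_i cst iota (v 0 i) * e (X i).
Proof.
rewrite ffrac_lin // raddf_sum; apply: eq_bigr => i _ /=.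
by rewrite rmorphM e_const.
Qed.

Lemma is_fractionX i : is_fraction I 1 'X_i (lin l).
Proof. by rewrite -lin_delta; apply: is_fraction_lin. Qed.

(** u is a root of the polynomial whose roots are the G-conjugates of u; its
    coefficients are invariant, so they lie in C(z). *)
Lemma aut_conjugate (s : {rmorphism K -> K}) d p q :
  galois_aut iota s -> is_fraction I d p q ->
  \prod_(x in G) (s (e (ffrac I p q)) - e (ffrac I (act x p) (act x q))) = 0.
Proof.
move=> [_ s_id] fr; pose c x := ffrac I (act x p) (act x q).
pose P := orbit_poly G c.
have P_inv i : exists r, P`_i = theta r.
  suff inv : ff_invariant rG P`_i.
    by have [_ /(_ P`_i)[/(_ inv)[r <-] _]] := theta_quot; exists r.
  move=> y Gy d' p' q' hp' hq' nq' def_Pi.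
  have [t [_ tP]] := aut_lift Gy; apply: (fmorph_inj e).
  have tP_id : map_poly t (map_poly e P) = map_poly e P.
    apply: (orbit_poly_fixed Gy) => x Gx.
    by rewrite (tP _ _ _ (is_fraction_act G_stable Gx fr)) !sym_actM -repr_mxM.
  rewrite -(tP d') // -def_Pi.
  by have := congr1 (fun r : {poly K} => r`_i) tP_id; rewrite !coef_map.
have [r rP] := choice P_inv.
have mapP : map_poly e P = map_poly iota (\poly_(i < size P) r i).
  apply/polyP => i; rewrite !coef_map coef_poly; case: ifP => [_|/negbT].
    by rewrite rP /= e_theta.
  by rewrite -leqNgt /= => /leq_sizeP->; rewrite // !rmorph0.
have sP : map_poly s (map_poly e P) = map_poly e P.
  by rewrite mapP; apply/polyP => i; rewrite !coef_map /= s_id.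
rewrite -orbit_poly_horner -/P -sP horner_map orbit_poly_horner.
rewrite (bigD1 1%g) ?group1 //= {1}/c repr_mx1 !sym_act1 subrr mul0r.
exact: rmorph0.
Qed.

(** The conjugating element of G may depend on the function, but all functions
    sum_i c^i X_i/l, with c a natural number, are treated at once: the product
    over G of the polynomials in c that compare s with x has all natural numbers
    as roots. *)
Lemma aut_on_functions (s : {rmorphism K -> K}) : galois_aut iota s ->
  exists2 x, x \in G & forall i, s (e (X i)) = e (ffrac I (act x 'X_i) (act x (lin l))).
Proof.
move=> s_aut; have [_ s_id] := s_aut.
pose y x i := s (e (X i)) - e (ffrac I (act x 'X_i) (act x (lin l))).
pose Q x := \poly_(j < n) oapp (y x) 0 (insub j : option 'I_n).
have Q_horner x (c : nat) : x \in G -> let v := \row_i c%:R ^+ i in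
    (Q x).[c%:R] = s (e (ffrac I (lin v) (lin l)))
                   - e (ffrac I (act x (lin v)) (act x (lin l))).
  move=> Gx v; have [t [[_ t_id] tP]] := aut_lift Gx.
  rewrite -(tP _ _ _ (is_fraction_lin v l_notin)) e_frac_lin !rmorph_sum -sumrB.
  rewrite horner_poly; apply: eq_bigr => i _.
  rewrite valK /= !rmorphM /= s_id t_id mxE -/(cst iota _) rmorphXn rmorph_nat.
  rewrite -mulrBr mulrC.
  by rewrite (tP _ _ _ (is_fractionX i)).
have prod0 : \prod_(x in G) Q x = 0.
  apply: (natr_root_eq0 (char_K iota charC)) => c; apply/rootP.
  have fr := is_fraction_lin (\row_i c%:R ^+ i) l_notin.
  rewrite horner_prod -[RHS](aut_conjugate s_aut fr).
  by apply: eq_bigr => x Gx; apply: Q_horner.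
move/eqP: prod0; rewrite prodf_seq_eq0 => /hasP[x _ /andP[Gx /eqP Qx]].
exists x => // i; apply/eqP; rewrite -subr_eq0 -/(y x i).
have := congr1 (fun p : {poly K} => p`_i) Qx.
by rewrite coef_poly ltn_ord valK coef0 /= => ->.
Qed.

End GaloisAction.

(** * Twists of spaces of functions *)

Section Twists.
Variables (C K : closedFieldType) (iota : {rmorphism {fraction {poly C}} -> K}).
Let k : {rmorphism C -> K} := cst iota.

(** The matrix of multiplication by m on a finite-dimensional C-space of
    functions has m as an eigenvalue, and C is algebraically closed. *)
Lemma multiplier_const n (b : 'I_n -> K) (M : 'M[C]_n) m :
  (exists i, b i != 0) ->
  (forall i, m * b i = \sum_j k (M i j) * b j) -> exists c, m = k c.
Proof.
move=> [i0 b0] mb; apply: (@root_over_C _ _ iota (char_poly M^T)).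
  by rewrite monic_neq0 ?char_poly_monic.
rewrite -[cst iota]/(k : C -> K) map_char_poly -eigenvalue_root_char.
apply/eigenvalueP; exists (\row_i b i); last first.
  by apply: contraNneq b0 => /rowP/(_ i0); rewrite !mxE => ->.
apply/rowP => i; rewrite !mxE mb; apply: eq_bigr => j _.
by rewrite !mxE mulrC.
Qed.

Lemma free_over_eq n (b : 'I_n -> K) (v w : 'rV[C]_n) : free_over k b ->
  \sum_j k (v 0 j) * b j = \sum_j k (w 0 j) * b j -> v = w.
Proof.
move=> b_free E; apply/eqP; rewrite -subr_eq0; apply/eqP/b_free.
rewrite -[RHS](subrr (\sum_j k (w 0 j) * b j)) -{1}E -sumrB.
by apply: eq_bigr => j _; rewrite !mxE rmorphB mulrBl.
Qed.

Lemma free_over_neq0 n (b : 'I_n -> K) : (0 < n)%N -> free_over k b ->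
  exists i, b i != 0.
Proof.
move=> n0 b_free; apply: contrapT => nb.
have : delta_mx 0 (Ordinal n0) = 0 :> 'rV[C]_n.
  apply: b_free; rewrite big1 // => i _; apply/eqP; apply: contraT => bi.
  by case: nb; exists i; apply: contraNneq bi => ->; rewrite mulr0.
by move/rowP/(_ (Ordinal n0)) => /eqP; rewrite !mxE !eqxx oner_eq0.
Qed.

(** The matrix S^-1 A describes multiplication by m, so m is a constant. *)
Lemma scalar_twist n (b : 'I_n -> K) (S A : 'M[C]_n) m :
  (0 < n)%N -> free_over k b -> S \in unitmx -> m != 0 ->
  (forall i, m * \sum_j k (S i j) * b j = \sum_j k (A i j) * b j) ->
  exists2 c, c != 0 & A = c *: S.
Proof.
move=> n0 b_free Su m0 SA.
have comb (M N : 'M[C]_n) i :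
    \sum_j k ((M *m N) i j) * b j = \sum_h k (M i h) * \sum_j k (N h j) * b j.
  under [RHS]eq_bigr do rewrite mulr_sumr.
  rewrite exchange_big; apply: eq_bigr => j _; rewrite mxE rmorph_sum mulr_suml.
  by apply: eq_bigr => h _; rewrite rmorphM mulrA.
have mb i : m * b i = \sum_j k ((invmx S *m A) i j) * b j.
  rewrite comb; under eq_bigr do rewrite -SA mulrCA.
  rewrite -mulr_sumr -comb mulVmx // (bigD1 i) //= mxE eqxx rmorph1 mul1r.
  rewrite big1 ?addr0 // => j ji.
  by rewrite mxE eq_sym (negbTE ji) rmorph0 mul0r.
have [c mc] := multiplier_const (free_over_neq0 n0 b_free) mb.
exists c; first by apply: contraNneq m0 => c0; rewrite mc c0 rmorph0.
apply/row_matrixP => i; apply: (free_over_eq b_free).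
transitivity (\sum_j k (A i j) * b j); first by apply: eq_bigr => j _; rewrite mxE.
rewrite -SA mc mulr_sumr; apply: eq_bigr => j _.
by rewrite !mxE rmorphM mulrA.
Qed.

End Twists.

Section AutomorphismsAndOperators.
Variables (C K : closedFieldType) (iota : {rmorphism {fraction {poly C}} -> K}).
Hypothesis charC : [pchar C] =i pred0.
Hypothesis K_alg : forall x, algebraicOver iota x.
Variable D : K -> K.
Hypothesis D_ddz : extends_ddz iota D.
Variable s : {rmorphism K -> K}.
Hypothesis s_aut : galois_aut iota s.

Lemma aut_cst c : s (cst iota c) = cst iota c.
Proof. by case: s_aut => _; apply. Qed.

Lemma aut_iter i y : s (iter i D y) = iter i D (s y).
Proof. by elim: i => //= i IH; rewrite (aut_ddz charC K_alg D_ddz) // IH. Qed.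

Lemma aut_op_eval L y : s (op_eval D L y) = op_eval D (map_poly s L) (s y).
Proof.
rewrite /op_eval rmorph_sum size_map_poly.
by apply: eq_bigr => i _; rewrite rmorphM coef_map aut_iter.
Qed.

Lemma aut_solution L y : solution D L y -> solution D (map_poly s L) (s y).
Proof. by rewrite /solution -aut_op_eval => ->; rewrite rmorph0. Qed.

Lemma aut_monic_op n L : monic_op n L -> monic_op n (map_poly s L).
Proof. by move=> [mL sL]; split; rewrite ?map_monic ?size_map_poly. Qed.

Lemma aut_free n (b : 'I_n -> K) : free_over (cst iota) b ->
  free_over (cst iota) (fun i => s (b i)).
Proof.
move=> b_free v v0; apply: b_free; apply: (fmorph_inj s).
rewrite rmorph0 -[RHS]v0 rmorph_sum; apply: eq_bigr => i _.
by rewrite rmorphM [s (cst _ _)]aut_cst.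
Qed.

(** s multiplies the Wronskian by det A; it is a non-zero constant when the
    coefficient of order n - 1 vanishes, hence fixed by s. *)
Lemma det_galois_group n (b : 'I_n.+1 -> K) L (A : 'M[C]_n.+1) :
  free_over (cst iota) b -> monic_op n.+1 L -> L`_n = 0 ->
  (forall i, solution D L (b i)) ->
  (forall i, s (b i) = \sum_j cst iota (A i j) * b j) -> \det A = 1.
Proof.
move=> b_free mo Ln kills sb; have dD := ddz_derivation D_ddz.
have := wronskian_unit dD (ddz_eq0 charC K_alg D_ddz) b_free.
rewrite unitmxE unitfE => w0.
have := abel dD (ddz_cst D_ddz) mo kills; rewrite Ln oppr0 mul0r.
case/(ddz_eq0 charC K_alg D_ddz) => c wc.
have sW : map_mx s (wronskian D b) = wronskian D b *m map_mx (cst iota) A^T.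
  apply/matrixP => i j; rewrite !mxE aut_iter sb.
  rewrite (big_morph (iter i D) (iter_derivationD dD i) (iter_derivation0 dD i)).
  apply: eq_bigr => h _; rewrite !mxE.
  by rewrite (iter_derivationZ dD (ddz_cst D_ddz)) mulrC.
have := congr1 determinant sW; rewrite det_map_mx det_mulmx det_map_mx det_tr.
rewrite {1}wc aut_cst -wc => E; apply: (fmorph_inj (cst iota)).
by apply: (mulfI w0); rewrite -E rmorph1 mulr1.
Qed.

End AutomorphismsAndOperators.

(** * The standard operator *)

Section StandardOperator.
Variables (C K : closedFieldType) (iota : {rmorphism {fraction {poly C}} -> K}).
Hypothesis charC : [pchar C] =i pred0.
Hypothesis K_alg : forall x, algebraicOver iota x.
Variable D : K -> K.
Hypothesis D_ddz : extends_ddz iota D.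
Variable n : nat.
Variables (gT : finGroupType) (G : {group gT}) (rG : mx_representation C G n.+1).
Hypothesis G_irr : mx_irreducible rG.
Variable I : prime_idealr {mpoly C[n.+1]}.
Hypothesis I_irr : irreducible_closed I.
Hypothesis G_stable : stable_variety I rG.
Variable theta : {rmorphism {fraction {poly C}} -> function_field I}.
Hypothesis theta_quot : quotient_identification rG theta.
Variable e : {rmorphism function_field I -> K}.
Hypothesis e_theta : forall r, e (theta r) = iota r.

Let dD := ddz_derivation D_ddz.
Let charK := char_K iota charC.
Let k : {rmorphism C -> K} := cst iota.
Let Dk : forall c, D (k c) = 0 := ddz_cst D_ddz.
Let D_eq0 : forall y, D y = 0 -> exists c, y = k c := ddz_eq0 charC K_alg D_ddz.

Let l_notin l : l != 0 -> lin l \notin I.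
Proof. by case: I_irr => _ I_proper; apply: lin_notin G_irr G_stable I_proper l. Qed.

Let fr_lin u l : l != 0 -> is_fraction I 1 (lin u) (lin l).
Proof. by move=> l0; apply/is_fraction_lin/l_notin. Qed.

Let X (l : 'rV[C]_n.+1) i := e (ffrac I 'X_i (lin l)).

Let frac_comb f l v : l != 0 ->
  f * e (ffrac I (lin v) (lin l)) = \sum_i k (v 0 i) * (f * X l i).
Proof.
move=> l0; rewrite (e_frac_lin theta_quot e_theta (l_notin l0)) mulr_sumr.
by apply: eq_bigr => i _; rewrite mulrCA.
Qed.

Lemma twisted_spaceP f l y : l != 0 -> twisted_space e f l y <->
  exists v : 'rV[C]_n.+1, y = \sum_i k (v 0 i) * (f * X l i).
Proof.
by move=> l0; split=> -[v ->]; exists v; rewrite frac_comb.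
Qed.

Let e_lin_neq0 u l : u != 0 -> l != 0 -> e (ffrac I (lin u) (lin l)) != 0.
Proof.
move=> u0 l0; rewrite fmorph_eq0.
exact: (ffrac_neq0 (fr_lin u l0) (l_notin u0)).
Qed.

Let X_free f l : f != 0 -> l != 0 -> free_over k (fun i => f * X l i).
Proof.
move=> f0 l0 v; rewrite -frac_comb // => v0; apply/eqP; apply: contraTT isT => vn0.
by move/eqP: v0; rewrite mulf_eq0 (negbTE f0) (negbTE (e_lin_neq0 vn0 l0)).
Qed.

Let X_change l l' i : l != 0 -> l' != 0 ->
  X l' i = e (ffrac I (lin l) (lin l')) * X l i.
Proof.
move=> l0 l0'; rewrite /X -rmorphM mulrC.
by rewrite (ffrac_cancel (is_fractionX (l_notin l0) i) (fr_lin l l0')).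
Qed.

(** h is a root of order n + 1 of the Wronskian of W, n + 1 being the order of L0:
    by Abel's formula, h'/h is then the shift that removes the coefficient n. *)
Lemma exists_standard_shift f l : f != 0 -> l != 0 -> exists L0 h,
  [/\ monic_op n.+1 L0, forall y, solution D L0 y <-> twisted_space e f l y,
      h != 0 & (op_shift D (D h / h) L0)`_n = 0].
Proof.
move=> f0 l0; have w_free := X_free f0 l0.
have [L0 [mo kills]] := monic_op_exists dD D_eq0 w_free.
have w0 : \det (wronskian D (fun i => f * X l i)) != 0.
  by rewrite -unitfE -unitmxE (wronskian_unit dD D_eq0 w_free).
set w := \det _ in w0.
have [h /rootP] : exists h : K, root ('X^(n.+1) - w%:P) h.
  by apply/closed_rootP; rewrite size_XnsubC.
rewrite !hornerE => /eqP; rewrite subr_eq0 => /eqP hn.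
have h0 : h != 0.
  by apply: contraNneq w0 => h0; rewrite -hn h0 expr0n.
exists L0, h; split=> //.
  move=> y; rewrite (monic_op_solution dD Dk D_eq0 w_free mo kills).
  by rewrite (twisted_spaceP _ _ l0).
have [_ ->] := op_shift_coefs dD (D h / h) mo.
have := abel dD Dk mo kills; rewrite -/w -hn (derivation_exp dD) => E.
have hn0 : h ^+ n.+1 != 0 by rewrite expf_neq0.
apply: (mulIf hn0); rewrite mul0r mulrDl -[L0`_n]opprK mulNr -E exprS.
have E3 : D h / h * (h * h ^+ n) = h ^+ n * D h by rewrite mulrA divfK // mulrC.
by rewrite -[X in X - _]mulrA E3 mulrA subrr.
Qed.

Variables (l : 'rV[C]_n.+1) (f : K).
Hypotheses (l_neq0 : l != 0) (f_neq0 : f != 0).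
Hypothesis W_stable : galois_stable iota (twisted_space e f l).
Variables (L0 : {poly K}) (h : K).
Hypothesis L0_monic : monic_op n.+1 L0.
Hypothesis L0_sol : forall y, solution D L0 y <-> twisted_space e f l y.
Hypothesis h_neq0 : h != 0.
Hypothesis shift_coef : (op_shift D (D h / h) L0)`_n = 0.

(** The standard operator before its coefficients are known to lie in C(z). *)
Let LK := op_shift D (D h / h) L0.
Let w i := f * X l i.
Let b i := h^-1 * w i.

Let hV_neq0 : h^-1 != 0. Proof. by rewrite invr_eq0. Qed.

Let w_free : free_over k w. Proof. exact: X_free. Qed.

Let scale_free m (u : 'I_n.+1 -> K) :
  m != 0 -> free_over k u -> free_over k (fun i => m * u i).
Proof.
move=> m0 u_free v v0; apply: u_free; apply: (mulfI m0).
rewrite mulr0 -[RHS]v0 mulr_sumr.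
by apply: eq_bigr => i _; rewrite mulrCA.
Qed.

Let b_free : free_over k b. Proof. exact: scale_free. Qed.

Let LK_monic : monic_op n.+1 LK.
Proof. by have [] := op_shift_coefs dD (D h / h) L0_monic. Qed.

Let LK_sol y : solution D LK y <-> twisted_space e f l (h * y).
Proof. by rewrite (solution_shift dD) // L0_sol. Qed.

Let w_in i : twisted_space e f l (w i).
Proof. by exists (delta_mx 0 i); rewrite lin_delta. Qed.

Let LK_kills i : solution D LK (b i).
Proof. by apply/LK_sol; rewrite /b mulVKf. Qed.

Let LK_comb y : solution D LK y <-> exists v : 'rV[C]_n.+1, y = \sum_i k (v 0 i) * b i.
Proof. exact: (monic_op_solution dD Dk D_eq0 b_free LK_monic LK_kills). Qed.

(** For s in the Galois group, L_st and its image under s have solution spaces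
    that differ by the factor h/s(h), because W is stable. *)
Let LK_aut (s : {rmorphism K -> K}) : galois_aut iota s -> map_poly s LK = LK.
Proof.
move=> s_aut; symmetry.
have sh0 : s h != 0 by rewrite fmorph_eq0.
have sw_free : free_over k (fun i => h^-1 * s (w i)).
  by apply: scale_free => //; apply: (aut_free s_aut).
apply: (@standard_form_unique _ _ k D dD Dk D_eq0 _ (fun i => h^-1 * s (w i))
  _ _ (h / s h)) => //.
- exact: aut_monic_op.
- by rewrite coef_map [LK`_n]shift_coef; apply: rmorph0.
- by rewrite mulf_neq0 ?invr_eq0.
- by move=> i; apply/LK_sol; rewrite mulVKf //; apply: W_stable.
move=> i; have := aut_solution charC K_alg D_ddz s_aut (LK_kills i).
by rewrite /b rmorphM fmorphV mulrA [_ / s h * _]mulrAC divff // mul1r.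
Qed.

Lemma standard_descends : exists Lst, map_poly iota Lst = LK.
Proof.
have coefF i : exists r, LK`_i = iota r.
  apply: (aut_fixed (char_ratfun charC) K_alg) => s s_aut.
  by rewrite -[in RHS](LK_aut s_aut) coef_map.
have [r rP] := choice coefF.
exists (\poly_(i < size LK) r i); apply/polyP => i; rewrite coef_map coef_poly.
case: ifP => [_|/negbT]; first exact: (esym (rP i)).
by rewrite -leqNgt => le; rewrite [RHS]nth_default //; exact: rmorph0.
Qed.

(** The spaces f' V/l' and f V/l differ by the factor m = (f'/f) (l/l'). *)
Lemma standard_operator_unique l' f' Lst Lst' : l' != 0 -> f' != 0 ->
  map_poly iota Lst = LK ->
  standard_operator iota D n.+1 (twisted_space e f' l') Lst' <-> Lst' = Lst.
Proof.
move=> l0' f0' LstE; pose m := f' / f * e (ffrac I (lin l) (lin l')).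
have m0 : m != 0 by rewrite !mulf_neq0 ?invr_eq0 ?e_lin_neq0.
have wm i : f' * X l' i = m * w i.
  by rewrite (X_change _ l_neq0 l0') /m /w [RHS]mulrACA divfK.
have Wm y : twisted_space e f' l' y <-> twisted_space e f l (m^-1 * y).
  rewrite !twisted_spaceP //; split=> -[v E]; exists v.
    rewrite E mulr_sumr; apply: eq_bigr => i _.
    by rewrite wm [k _ * (m * _)]mulrCA mulKf.
  rewrite -[y](mulVKf m0) E mulr_sumr; apply: eq_bigr => i _.
  by rewrite wm mulrCA.
split=> [[L' [h' [mo' sol' h0' E' c']]]|->].
  apply: (map_poly_inj iota); rewrite LstE; symmetry.
  have [mo'' _] := op_shift_coefs dD (D h' / h') mo'.
  apply: (@standard_form_unique _ _ k D dD Dk D_eq0 _ b _ _ (h'^-1 * m * h)) => //.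
  - by rewrite E'.
  - by rewrite coef_map c'; apply: rmorph0.
  - by apply: mulf_neq0 => //; apply: mulf_neq0; rewrite ?invr_eq0.
  move=> i; rewrite E'; apply/(solution_shift dD) => //; apply/sol'/Wm.
  rewrite [h' * _](_ : _ = m * w i); first by rewrite mulKf.
  by rewrite !mulrA divff // mul1r mulfK.
have mV0 : m^-1 != 0 by rewrite invr_eq0.
have mh0 : m * h != 0 by rewrite mulf_neq0.
have [mo1 _] := op_shift_coefs dD (D m^-1 / m^-1) L0_monic.
exists (op_shift D (D m^-1 / m^-1) L0), (m * h); split=> //.
- by move=> y; rewrite (solution_shift dD) // L0_sol Wm.
- rewrite LstE; have [mo2 _] := op_shift_coefs dD (D (m * h) / (m * h)) mo1.
  apply: (monic_op_unique dD D_eq0 b_free LK_monic mo2 LK_kills) => i.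
  apply/(solution_shift dD) => //; apply/(solution_shift dD) => //.
  by apply/L0_sol; rewrite -mulrA mulKf // /b mulVKf.
- by apply: (fmorph_inj iota); rewrite rmorph0 -coef_map LstE.
Qed.

(** s and x agree on the functions X_i/l, so on h^-1 W they differ by a twist,
    which is a constant. *)
Let aut_matrix (s : {rmorphism K -> K}) x (B : 'M[C]_n.+1) :
  galois_aut iota s -> x \in G ->
  (forall i, s (X l i) = e (ffrac I (sym_act (rG x) 'X_i) (sym_act (rG x) (lin l)))) ->
  (forall i, s (b i) = \sum_j k (B i j) * b j) ->
  exists2 c, c != 0 & B = c *: rG x.
Proof.
move=> s_aut Gx sX sb.
have lx0 : l *m rG x != 0.
  apply: contraNneq l_neq0 => lx0; have := repr_mxK rG Gx l.
  by rewrite lx0 mul0mx => <-.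
pose m := s (h^-1 * f) * e (ffrac I (lin l) (lin (l *m rG x))) / (h^-1 * f).
have hf0 : h^-1 * f != 0 by rewrite mulf_neq0.
apply: (@scalar_twist _ _ iota _ b _ _ m) => //.
- exact: repr_mx_unit.
- by rewrite !mulf_neq0 ?invr_eq0 ?fmorph_eq0 -?(fmorph_eq0 e) ?e_lin_neq0.
move=> i; rewrite -sb /b /w mulrA rmorphM /= sX sym_actX sym_act_lin.
have -> : e (ffrac I (lin (row i (rG x))) (lin (l *m rG x))) =
    e (ffrac I (lin l) (lin (l *m rG x))) * e (ffrac I (lin (row i (rG x))) (lin l)).
  rewrite -rmorphM mulrC.
  by rewrite (ffrac_cancel (fr_lin _ l_neq0) (fr_lin l lx0)).
rewrite (e_frac_lin theta_quot e_theta (l_notin l_neq0)) mulrA !mulr_sumr.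
apply: eq_bigr => j _; rewrite mxE /m -/(X l j) mulrA.
by rewrite [h^-1 * (f * X l j)]mulrA [LHS]mulrACA divfK.
Qed.

Lemma projective_galois_group A : projective_image (diff_galois_group iota b) A <->
  projective_image (fun B => exists2 x, x \in G & B = rG x) A.
Proof.
split=> -[B [c [hB c0 ->]]].
  have [s [s_aut sb]] := hB.
  have [x Gx sX] := aut_on_functions charC K_alg G_stable theta_quot e_theta
    (l_notin l_neq0) s_aut.
  have [d d0 ->] := aut_matrix s_aut Gx sX sb.
  by exists (rG x), (c * d); split; rewrite ?mulf_neq0 ?scalerA //; exists x.
have [x Gx ->] := hB.
have [s [s_aut sE]] := aut_lift K_alg G_stable theta_quot e_theta Gx.
have sb i : exists v : 'rV[C]_n.+1, s (b i) = \sum_j k (v 0 j) * b j.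
  apply/LK_comb; rewrite -(LK_aut s_aut).
  exact: (aut_solution charC K_alg D_ddz s_aut).
have [v vP] := choice sb; pose M := \matrix_i v i.
have sM i : s (b i) = \sum_j k (M i j) * b j.
  by rewrite vP; apply: eq_bigr => j _; rewrite mxE.
have sX i := sE _ _ _ (is_fractionX (l_notin l_neq0) i).
have [d d0 ME] := aut_matrix s_aut Gx sX sM.
exists M, (c / d); split; rewrite ?mulf_neq0 ?invr_eq0 //; first by exists s.
by rewrite ME scalerA divfK.
Qed.

(** On forms of degree d, evaluation at the basis b is p |-> (f/h)^d p/l^d. *)
Lemma mmap_basis d p : p \is d.-homog ->
  (mmap (cst iota) b p == 0) = (p \in I).
Proof.
move=> hp; have nl := l_notin l_neq0.
have hf0 : h^-1 * f != 0 by rewrite mulf_neq0.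
have -> : mmap (cst iota) b p =
    (h^-1 * f) ^+ d * e (mmap (ff_const I) (fun i => ffrac I 'X_i (lin l)) p).
  rewrite /mmap rmorph_sum mulr_sumr !big_seq; apply: eq_bigr => m mp.
  rewrite rmorphM (e_const theta_quot e_theta) [RHS]mulrCA; congr (_ * _).
  have <- : mdeg m = d := dhomogP _ _ _ hp m mp.
  rewrite mdegE -prodrXr /mmap1 rmorph_prod -big_split; apply: eq_bigr => i _ /=.
  by rewrite rmorphXn -exprMn -mulrA.
have nld : lin l ^+ d \notin I.
  have Ix (q : {mpoly C[n.+1]}) j : q \notin I -> q ^+ j \notin I.
    move=> nq; elim: j => [|j IH]; first by rewrite expr0 idealr1.
    by rewrite exprS prime_idealrM negb_or nq.
  exact: Ix.
have fr : is_fraction I d p (lin l ^+ d).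
  by split=> //; rewrite -[X in X.-homog]mul1n dhomogMn ?lin_homog.
rewrite (mmap_homog nl hp) mulf_eq0 expf_eq0 (negbTE hf0) andbF fmorph_eq0.
exact: (ffrac_eq0 fr).
Qed.

(** An element of I is the sum of its homogeneous components, which are in I. *)
Lemma fano_idealP p : (n.+1 = 2%N -> forall q, q \in I <-> q = 0) ->
  fano_ideal iota b p <-> p \in I.
Proof.
move=> I_eq2; rewrite /fano_ideal; case: eqP => [/I_eq2 I0|_]; first by rewrite I0.
split=> [[m [a [q [hq ->]]]]|pI].
  apply: rpred_sum => i _; apply: idealMr; have [[d hd] /eqP] := hq i.
  by rewrite (mmap_basis hd).
have [hom _] := I_irr; exists (msize p), (fun _ => 1), (fun d => pihomog mdeg d p).
split=> [d|].
  have hd := pihomogP mdeg d p; split; first by exists d.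
  by apply/eqP; rewrite (mmap_basis hd) hom.
rewrite {1}(pihomog_partitionE (leqnn (msize p))); apply: eq_bigr => d _.
by rewrite mul1r.
Qed.

Lemma det_basis A : diff_galois_group iota b A -> \det A = 1.
Proof.
move=> [s [s_aut sb]].
exact: (det_galois_group charC K_alg D_ddz s_aut b_free LK_monic shift_coef
  LK_kills sb).
Qed.

Lemma solution_scaled y : solution D LK y <->
  exists u, twisted_space e f l u /\ y = h^-1 * u.
Proof.
rewrite LK_sol; split=> [Wy|[u [Wu ->]]]; last by rewrite mulVKf.
by exists (h * y); rewrite mulKf.
Qed.

Lemma basis_solution : is_basis iota b (solution D LK).
Proof. by split; [exact: LK_comb | exact: b_free]. Qed.

End StandardOperator.

Theorem corollary3p3
  (C : closedFieldType) (pcharC : [pchar C] =i pred0)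
  (* K is the algebraic closure of C(z), with the derivation d/dz *)
  (K : closedFieldType) (iota : {rmorphism {fraction {poly C}} -> K})
  (K_alg : forall x, algebraicOver iota x)
  (D : K -> K) (D_ddz : extends_ddz iota D)
  (* G is an irreducible finite subgroup of GL(V), V = C^n *)
  (n : nat) (n_ge2 : (2 <= n)%N)
  (gT : finGroupType) (G : {group gT}) (rG : mx_representation C G n)
  (G_faithful : mx_faithful rG) (G_irr : mx_irreducible rG)
  (* Z is the subvariety of P(V) defined by I *)
  (I : prime_idealr {mpoly C[n]})
  (Z_eq2 : n = 2%N -> forall p, p \in I <-> p = 0)
  (Z_gt2 : (2 < n)%N -> irreducible_curve I /\ stable_variety I rG)
  (* C(z) = C(Z)^(G^p), and C(Z) is embedded in K over C(z) *)
  (theta : {rmorphism {fraction {poly C}} -> function_field I})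
  (theta_quot : quotient_identification rG theta)
  (z_eq2 : n = 2%N -> branched_at_0_1_oo theta)
  (e : {rmorphism function_field I -> K})
  (e_theta : forall r, e (theta r) = iota r)
  (l : 'rV[C]_n) (l_neq0 : l != 0) (f : K) (f_neq0 : f != 0)
  (W_stable : galois_stable iota (twisted_space e f l)) :
  exists Lst : {poly {fraction {poly C}}},
    standard_operator iota D n (twisted_space e f l) Lst /\
    (* (1) *)
    (forall (l' : 'rV[C]_n) (f' : K), l' != 0 -> f' != 0 ->
       galois_stable iota (twisted_space e f' l') ->
       forall Lst', standard_operator iota D n (twisted_space e f' l') Lst' <->
                    Lst' = Lst) /\
    exists g : K, g != 0 /\
      (* (2) *)
      (forall y, solution D (map_poly iota Lst) y <->
         exists w, twisted_space e f l w /\ y = g * w) /\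
      (* b is the basis of the solution space g W corresponding to the
         standard basis of V under v |-> g f v/l *)
      let b := fun i => g * (f * e (ffrac I (lin (delta_mx 0 i)) (lin l))) in
      is_basis iota b (solution D (map_poly iota Lst)) /\
      (* (3) *)
      (forall A, diff_galois_group iota b A -> \det A = 1) /\
      (* (4) *)
      (forall A, projective_image (diff_galois_group iota b) A <->
                 projective_image (fun B => exists2 x, x \in G & B = rG x) A) /\
      (forall p, fano_ideal iota b p <-> p \in I).
Proof.
case: n n_ge2 rG G_faithful G_irr I Z_eq2 Z_gt2 theta theta_quot z_eq2 e e_theta
  l l_neq0 f f_neq0 W_stable => [//|n'] n_ge2' rG' _ G_irr' I' I_eq2 I_gt2 theta'
  theta_quot' _ e' e_theta' l' l_neq0' f' f_neq0' W_stable'.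
have [I_irr G_stable] : irreducible_closed I' /\ stable_variety I' rG'.
  have [n2|n2] := eqVneq n'.+1 2; last first.
    have [|[I_irr _] G_stable] := I_gt2 _ => //.
    by rewrite ltn_neqAle eq_sym n2.
  (* On the projective line the ideal is zero. *)
  have I0 := I_eq2 n2; split; last first.
    move=> x p _ /I0->; apply/I0; exact: raddf0.
  split=> [p d /I0->|]; first by apply/I0; apply: raddf0.
  exists ord0; apply/negP => /I0; rewrite -lin_delta => /lin_eq0/rowP/(_ ord0).
  by rewrite !mxE !eqxx => /eqP; rewrite oner_eq0.
have [L0 [h [L0_monic L0_sol h_neq0 shift_coef]]] :=
  exists_standard_shift pcharC K_alg D_ddz G_irr' I_irr G_stable theta_quot' e_theta'
    f_neq0' l_neq0'.
have [Lst LstE] :=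
  standard_descends pcharC K_alg D_ddz G_irr' I_irr G_stable theta_quot' e_theta'
    l_neq0' f_neq0' W_stable' L0_monic L0_sol h_neq0 shift_coef.
have unique := standard_operator_unique pcharC K_alg D_ddz G_irr' I_irr G_stable
  theta_quot' e_theta' l_neq0' f_neq0' L0_monic L0_sol h_neq0 shift_coef.
exists Lst; split; first exact/(unique _ _ _ _ l_neq0' f_neq0' LstE).
split; first by move=> l'' f'' l0 f0 _ Lst'; apply: unique.
exists h^-1; split; first by rewrite invr_eq0.
rewrite LstE; split; first exact: (solution_scaled D_ddz L0_sol h_neq0).
have -> : (fun i => h^-1 * (f' * e' (ffrac I' (lin (delta_mx 0 i)) (lin l')))) =
          (fun i => h^-1 * (f' * e' (ffrac I' 'X_i (lin l')))).
  by apply/funext => i; rewrite lin_delta.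
split.
  exact: (basis_solution pcharC K_alg D_ddz G_irr' I_irr G_stable theta_quot'
    e_theta' l_neq0' f_neq0' L0_monic L0_sol h_neq0).
split.
  exact: (det_basis pcharC K_alg D_ddz G_irr' I_irr G_stable theta_quot'
    e_theta' l_neq0' f_neq0' L0_monic L0_sol h_neq0 shift_coef).
split.
  exact: (projective_galois_group pcharC K_alg D_ddz G_irr' I_irr G_stable theta_quot'
    e_theta' l_neq0' f_neq0' W_stable' L0_monic L0_sol h_neq0 shift_coef).
by move=> p; apply: (fano_idealP G_irr' I_irr G_stable theta_quot').
Qed.
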